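(* Consider an irreducible and finitely supported $\mu$-random walk on a finitely generated non-amenable group $G$. Then the identity map on $G$ extends to an injective map $\Psi$ from the Morse boundary of $G$ to the Martin boundary $\partial_{\mathcal M}G$ of $(G,\mu)$, and $\Psi$ is continuous with respect to the direct limit topology on the Morse boundary.
   Context: Random walk and Martin boundary. $\mu$ is a finitely supported probability measure on $G$; irreducible means that for all $x,y\in G$ there is $n$ with $p_n(x,y):=\mu^{*n}(x^{-1}y)>0$. $\mathcal G(x,y)=\sum_{n\ge0}p_n(x,y)$ (finite, since $G$ is non-amenable), $K_y(x)=\mathcal G(x,y)/\mathcal G(e,y)$. The Martin boundary $\partial_{\mathcal M}G$ is the set of pointwise limits $K_\zeta=\lim K_{y_n}$ along sequences $y_n$ leaving every finite subset, with the topology of pointwise convergence; $y_n\to\zeta$ means $K_{y_n}\to K_\zeta$ pointwise. Morse boundary. Fix a Cayley graph of $G$ for a finite symmetric generating set. For $\kappa:[1,\infty)\to[0,\infty)$, a geodesic is $\kappa$-Morse if every $c$-quasi-geodesic with endpoints on it stays in its $\kappa(c)$-neighborhood, for all $c\ge1$. The Morse boundary is the set of equivalence classes of geodesic rays from $e$ that are $\kappa$-Morse for some $\kappa$, two rays being equivalent if they are at finite Hausdorff distance. For each $\kappa$, the stratum of classes represented by $\kappa$-Morse rays from $e$ carries the (quotient) topology of uniform convergence on compact sets of such rays; the Morse boundary carries the direct limit topology over the gauges $\kappa$ (Cordes). That the identity extends to $\Psi$ means that for each Morse geodesic ray with vertices $g_0=e,g_1,g_2,\dots$ representing a point $\xi$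 of the Morse boundary, $g_n\to\Psi(\xi)$ in the Martin compactification. *)

(* Defs.v *)
From HB Require Import structures.
From mathcomp Require Import all_boot all_order all_algebra.
From mathcomp Require Import all_classical all_reals all_analysis.
Set Implicit Arguments.
Unset Strict Implicit.
Unset Printing Implicit Defensive.
Import Order.TTheory GRing.Theory Num.Theory.
Import numFieldNormedType.Exports.
Local Open Scope classical_set_scope.
Local Open Scope ring_scope.

(* Amenability: there is a finitely additive, left-invariant probability
   measure on the family of all subsets of G. *)
Definition amenable (R : realType) (G : groupType) : Prop :=
  exists m : set G -> R,
    [/\ forall A, 0 <= m A,
        m [set: G] = 1,
        forall A B, A `&` B = set0 -> m (A `|` B) = m A + m B
      & forall (g : G) A, m [set (g * x)%g | x in A] = m A].

Section WordMetric.
Context {G : groupType}.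
Implicit Types S : set G.

Definition finite_symmetric_generating S : Prop :=
  [/\ finite_set S,
      forall s, S s -> S s^-1%g
    & forall g : G, exists2 w : seq G,
        [set` w] `<=` S & (\prod_(s <- w) s)%g = g].

Definition word_lengths S (g : G) : set nat :=
  [set size w | w in [set w : seq G | [set` w] `<=` S /\
                                      (\prod_(s <- w) s)%g = g]].

(* The default value 0 is never used when S generates G. *)
Definition word_norm S (g : G) : nat :=
  xget 0%N (word_lengths S g `&` lbound (word_lengths S g)).

(* The graph distance between the vertices x and y of the Cayley graph with
   edges {x, x * s}, s in S. *)
Definition word_dist S (x y : G) : nat := word_norm S (x^-1 * y)%g.

End WordMetric.

(* A geodesic ray of the Cayley graph issued from the vertex 1 is encoded by the
   sequence of its vertices; this loses nothing, as such a ray is at a vertex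
   exactly at integer times.  The topology is that of uniform convergence on
   compact sets. *)
Notation vertex_path G := {family compact, nat -> discrete_topology G}.

Section MorseBoundary.
Context (R : realType) {G : groupType}.
Implicit Types (S : set G) (gamma : vertex_path G).

Definition geodesic_ray S gamma : Prop :=
  gamma 0%N = 1%g /\
  forall m n, (m <= n)%N -> word_dist S (gamma m) (gamma n) = (n - m)%N.

(* A c-quasi-geodesic is a (c, c)-quasi-isometric embedding of [a, b], not
   necessarily continuous.  Moving points of the Cayley graph to nearest
   vertices changes c by a bounded amount only, so vertex-valued q suffice:
   this alters gauges, but neither the boundary nor its direct limit topology. *)
Definition quasi_geodesic S (c a b : R) (q : R -> G) : Prop :=
  forall s t, s \in `[a, b] -> t \in `[a, b] ->
    c^-1 * `|s - t| - c <= (word_dist S (q s) (q t))%:R <= c * `|s - t| + c.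

(* L is the vertex set of a geodesic, kappa a gauge, of which only the values
   on [1, +oo) matter. *)
Definition kappa_Morse S (kappa : R -> {nonneg R}) (L : set G) : Prop :=
  forall c, 1 <= c ->
  forall (a b : R) (q : R -> G), a <= b -> quasi_geodesic S c a b q ->
    L (q a) -> L (q b) ->
  forall t, t \in `[a, b] ->
    exists2 v, L v & (word_dist S (q t) v)%:R <= (kappa c)%:num.

Definition kappa_Morse_rays S (kappa : R -> {nonneg R}) :
    set (vertex_path G) :=
  [set gamma | geodesic_ray S gamma /\ kappa_Morse S kappa (range gamma)].

Definition Morse_rays S : set (vertex_path G) :=
  \bigcup_kappa kappa_Morse_rays S kappa.

Definition finite_Hausdorff_dist S (A B : set G) : Prop :=
  exists C : nat,
    (forall x, A x -> exists2 y, B y & (word_dist S x y <= C)%N) /\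
    (forall y, B y -> exists2 x, A x & (word_dist S y x <= C)%N).

Definition ray_class S gamma : set (vertex_path G) :=
  [set gamma' | Morse_rays S gamma' /\
                finite_Hausdorff_dist S (range gamma) (range gamma')].

Definition Morse_boundary S : Type :=
  set_type [set ray_class S gamma | gamma in Morse_rays S].

HB.instance Definition _ S := Choice.on (Morse_boundary S).

Definition rays_of S (xi : Morse_boundary S) : set (vertex_path G) :=
  set_val xi.

Lemma kappa_ray_class_subproof S kappa (gamma : kappa_Morse_rays S kappa) :
  ray_class S (set_val gamma) \in
    [set ray_class S gamma | gamma in Morse_rays S].
Proof.
apply/mem_set; exists (set_val gamma) => //.
by exists kappa => //; exact: set_valP.
Qed.

Definition kappa_ray_class S kappa (gamma : kappa_Morse_rays S kappa) :
    Morse_boundary S :=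
  exist _ (ray_class S (set_val gamma)) (kappa_ray_class_subproof gamma).

Definition stratum S kappa : set (Morse_boundary S) :=
  range (@kappa_ray_class S kappa).

(* Open sets of the quotient topology on the stratum. *)
Definition stratum_open S kappa (V : set (Morse_boundary S)) : Prop :=
  V `<=` stratum kappa /\ open (@kappa_ray_class S kappa @^-1` V).

Definition direct_limit_open S : set_system (Morse_boundary S) :=
  [set U | forall kappa, stratum_open kappa (U `&` stratum kappa)].

Lemma preimage_stratum S kappa (U : set (Morse_boundary S)) :
  @kappa_ray_class S kappa @^-1` (U `&` stratum kappa) =
  @kappa_ray_class S kappa @^-1` U.
Proof.
by apply/seteqP; split => [gamma []//|gamma Ug]; split => //; exists gamma.
Qed.

Lemma direct_limit_openE S (U : set (Morse_boundary S)) :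
  direct_limit_open U <->
  forall kappa, open (@kappa_ray_class S kappa @^-1` U).
Proof.
split=> H kappa; first by have [_] := H kappa; rewrite preimage_stratum.
by split; [exact: subIsetr | rewrite preimage_stratum].
Qed.

Lemma direct_limit_openT S : @direct_limit_open S setT.
Proof.
by apply/direct_limit_openE => kappa; rewrite preimage_setT; exact: openT.
Qed.

Lemma direct_limit_openI S : setI_closed (@direct_limit_open S).
Proof.
move=> U V /direct_limit_openE oU /direct_limit_openE oV.
by apply/direct_limit_openE => kappa; rewrite preimage_setI; exact: openI.
Qed.

Lemma direct_limit_open_bigU S (I : Type) (f : I -> set (Morse_boundary S)) :
  (forall i, direct_limit_open (f i)) -> direct_limit_open (\bigcup_i f i).
Proof.
move=> of_; apply/direct_limit_openE => kappa; rewrite preimage_bigcup.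
by apply: bigcup_open => i _; have /direct_limit_openE := of_ i; exact.
Qed.

HB.instance Definition _ S :=
  isOpenTopological.Build (Morse_boundary S)
    (@direct_limit_openT S) (@direct_limit_openI S) (@direct_limit_open_bigU S).

End MorseBoundary.

Section MartinBoundary.
Context {R : realType} {G : groupType}.
Implicit Types mu nu : G -> R.

Definition finitely_supported_probability mu : Prop :=
  [/\ forall x, 0 <= mu x,
      finite_set [set x | mu x != 0]
    & \sum_(x \in [set: G]) mu x = 1].

Definition convolution mu nu : G -> R :=
  fun z => \sum_(y \in [set: G]) mu y * nu (y^-1 * z)%g.

Definition convolution_power mu n : G -> R :=
  iter n (convolution mu) (fun x => (x == 1%g)%:R).

Definition transition mu n (x y : G) : R := convolution_power mu n (x^-1 * y)%g.

Definition irreducible mu : Prop :=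
  forall x y, exists n, 0 < transition mu n x y.

Definition green mu (x y : G) : \bar R :=
  (\sum_(0 <= n <oo) (transition mu n x y)%:E)%E.

Definition martin_kernel mu (y : G) : {ptws G -> R} :=
  fun x => fine (green mu x y) / fine (green mu 1%g y).

Definition leaves_finite_sets (y : nat -> G) : Prop :=
  forall F : set G, finite_set F -> \forall n \near \oo, ~ F (y n).

Definition Martin_boundary mu : set {ptws G -> R} :=
  [set K | exists2 y : nat -> G, leaves_finite_sets y &
     {ptws, martin_kernel mu (y n) @[n --> \oo] --> K}].

End MartinBoundary.

(* Main.v *)
Require Import Defs.
From mathcomp Require Import all_boot all_order all_algebra.
From mathcomp Require Import all_classical all_reals all_analysis.
From mathcomp Require Import zify ring lra.
Import Order.TTheory GRing.Theory Num.Theory.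
Import numFieldNormedType.Exports.
Local Open Scope classical_set_scope.
Local Open Scope ring_scope.
Set Implicit Arguments.
Unset Strict Implicit.
Unset Printing Implicit Defensive.

(* Replacing mu by its lazy version only doubles the Green function G.  By
   non-amenability the lazy convolution powers decay exponentially (Kesten, Day).

   Let z lie on a kappa-Morse ray.  Adding to the Cayley graph all edges that join
   points less than a constant La apart in time on a path w gives a graph
   bi-Lipschitz to it, so its geodesics are quasi-geodesics and, when the ends of
   w lie on the ray, pass near z.  If w avoids a large ball around z, such a
   geodesic must leave w near z: w then contains a section from a to b that takes
   time at least La (d(a, z) + d(z, b)) up to a constant.  For La large the decay
   beats both the number of pairs (a, b) and the Harnack constants, so that paths
   avoiding B(z, D) contribute at most eps G(x, y) to G(x, y): Ancona's inequality.

   A limit K of Martin kernels along rays with a common Morse gauge thus nearly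
   equals its balayage on B(z, D) for every z far along the ray.  Positive
   harmonic functions with this property are proportional: if a is the largest
   constant with a K' <= K, then K - a K' has the property as well, hence is
   bounded below by a multiple of K'.  With ultrafilter limits, this uniqueness
   yields convergence, independence of the ray, and continuity on each stratum. *)

(** * Word metrics *)

(** Outside hyperbolic groups an Ancona inequality can be expected only along special geodesics.
    Here its constants depend on the gauge and not on the ray, and this uniformity is what gives
    continuity on each stratum. Laziness supplies atoms at 1 and at all generators for one common
    convolution power, as the l2 argument behind Kesten's theorem requires; mu may be asymmetric, so
    the norm of the convolution operator is estimated instead of a spectral radius. Injectivity has
    its own argument. If z lies on a ray with limit kernel K, then K(z) is at least a constant over
    G(1,z). If a second ray has the same limit, then G(z,z')/G(1,z') is close to K(z) for z' far
    along it, so the walk from 1 conditioned to reach z' visits z with probability bounded below.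
    The estimate for paths that avoid balls, now used along the second ray, confines such z to a
    bounded neighbourhood of that ray. *)

Section WordMetricTheory.
Context {G : groupType} (S : set G).
Hypothesis genS : finite_symmetric_generating S.

Lemma word_norm_min (g : G) :
  word_lengths S g (word_norm S g) /\ lbound (word_lengths S g) (word_norm S g).
Proof.
have [_ _ /(_ g) [w wS wg]] := genS.
have ne : exists n, `[< word_lengths S g n >].
  by exists (size w); apply/asboolP; exists w.
have [n /asboolP nP nmin] := ex_minnP ne.
apply: (@xgetPex _ 0%N (word_lengths S g `&` lbound (word_lengths S g))).
by exists n; split => // k kP; exact/nmin/asboolP.
Qed.

Lemma word_normP (g : G) : exists w : seq G,
  [/\ [set` w] `<=` S, (\prod_(s <- w) s)%g = g & size w = word_norm S g].
Proof. by have [[w [wS wg] wn] _] := word_norm_min g; exists w. Qed.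

Lemma word_norm_le (w : seq G) :
  [set` w] `<=` S -> (word_norm S (\prod_(s <- w) s)%g <= size w)%N.
Proof. by move=> wS; apply: (word_norm_min _).2; exists w. Qed.

Lemma word_norm1 : word_norm S 1%g = 0%N.
Proof.
have: (word_norm S (\prod_(s <- ([::] : seq G)) s)%g <= 0)%N.
  exact: word_norm_le.
by rewrite big_nil leqn0 => /eqP.
Qed.

Lemma word_normM (g h : G) :
  (word_norm S (g * h)%g <= word_norm S g + word_norm S h)%N.
Proof.
have [u [uS ug <-]] := word_normP g; have [v [vS vh <-]] := word_normP h.
rewrite -ug -vh -big_cat -size_cat; apply: word_norm_le => s /=.
by rewrite mem_cat => /orP[/uS|/vS].
Qed.

Lemma word_normV_le (g : G) : (word_norm S g^-1%g <= word_norm S g)%N.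
Proof.
have [_ Sinv _] := genS; have [w [wS wg <-]] := word_normP g.
have -> : (g^-1 = \prod_(s <- rev [seq s^-1 | s <- w]) s)%g.
  rewrite -wg; elim: w {wS wg} => [|s w IH]; first by rewrite !big_nil invg1.
  by rewrite /= rev_cons big_rcons /= big_cons invgM IH.
rewrite -(size_map (fun s => s^-1%g) w) -size_rev; apply: word_norm_le => s /=.
by rewrite mem_rev => /mapP[t /wS /Sinv tS ->].
Qed.

Lemma word_normV (g : G) : word_norm S g^-1%g = word_norm S g.
Proof.
by apply/eqP; rewrite eqn_leq word_normV_le -{1}(invgK g) word_normV_le.
Qed.

Lemma word_norm_gen (s : G) : S s -> (word_norm S s <= 1)%N.
Proof.
move=> sS; have -> : s = (\prod_(t <- [:: s]) t)%g by rewrite big_seq1.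
by apply: word_norm_le => t /=; rewrite inE => /eqP ->.
Qed.

Local Notation dist := (word_dist S).

Lemma dist_refl x : dist x x = 0%N.
Proof. by rewrite /word_dist mulVg word_norm1. Qed.

Lemma dist_sym x y : dist x y = dist y x.
Proof. by rewrite /word_dist -word_normV invgM invgK. Qed.

Lemma dist_tri y x z : (dist x z <= dist x y + dist y z)%N.
Proof.
rewrite /word_dist; have -> : (x^-1 * z = (x^-1 * y) * (y^-1 * z))%g.
  by rewrite mulgA mulgK.
exact: word_normM.
Qed.

Lemma dist_mulr x g : dist x (x * g)%g = word_norm S g.
Proof. by rewrite /word_dist mulKg. Qed.

Definition gens : seq G := finmap.enum_fset (fset_set S).

Lemma mem_gens s : (s \in gens) = (s \in S).
Proof.
have [Sfin _ _] := genS.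
by rewrite -(in_fset_set Sfin).
Qed.

(* Multiplicities are allowed: [sphere m] lists the elements of norm [m] and
   possibly shorter ones. *)
Fixpoint sphere (m : nat) : seq G :=
  if m is m'.+1 then [seq (s * g)%g | s <- gens, g <- sphere m'] else [:: 1%g].

Lemma size_sphere m : size (sphere m) = (size gens ^ m)%N.
Proof. by elim: m => // m IH /=; rewrite size_allpairs IH expnS. Qed.

Lemma sphere_norm g : g \in sphere (word_norm S g).
Proof.
have [w [wS <- <-]] := word_normP g; elim: w wS => [|s w IH] wS.
  by rewrite big_nil inE.
rewrite big_cons /=; apply: allpairs_f; first by
  rewrite mem_gens; apply/mem_set/wS; rewrite /= inE eqxx.
by apply: IH => t tw; apply: wS; rewrite /= inE tw orbT.
Qed.

Lemma sphereP m g : g \in sphere m -> (word_norm S g <= m)%N.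
Proof.
elim: m g => [|m IH] g /=; first by rewrite inE => /eqP ->; rewrite word_norm1.
case/allpairsP => -[s h] /= [sS /IH hm ->].
rewrite mem_gens inE in sS.
by rewrite (leq_trans (word_normM _ _))// -(add1n m) leq_add // word_norm_gen.
Qed.

(** Duplicates are removed because balls index sums of hitting probabilities, where each point may
    count only once. *)
Definition ball (z : G) (D : nat) : seq G :=
  undup [seq (z * u)%g | u <- flatten [seq sphere m | m <- iota 0 D.+1]].

Lemma mem_ball z D x : (x \in ball z D) = (dist z x <= D)%N.
Proof.
rewrite mem_undup; apply/mapP/idP => [[u /flattenP[_ /mapP[m mD ->] um] ->]|zx].
  rewrite dist_mulr (leq_trans (sphereP um))//.
  by move: mD; rewrite mem_iota add0n ltnS.
exists (z^-1 * x)%g; last by rewrite mulgA mulgV mul1g.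
apply/flattenP; exists (sphere (dist z x)); last exact: sphere_norm.
by apply/mapP; exists (dist z x) => //; rewrite mem_iota add0n ltnS.
Qed.

Lemma ball_uniq z D : uniq (ball z D).
Proof. exact: undup_uniq. Qed.

Lemma size_ball_le D : exists C, forall z, (size (ball z D) <= C)%N.
Proof.
exists (size (flatten [seq sphere m | m <- iota 0 D.+1])) => z.
by rewrite (leq_trans (size_undup _)) // size_map.
Qed.

End WordMetricTheory.

(** * Non-amenability and decay of convolution powers *)

Lemma cvg_le {R : realType} {T : Type} (F : set_system T) {FF : ProperFilter F}
    (f g : T -> R) (l l' : R) : f @ F --> l -> g @ F --> l' ->
  (\forall t \near F, f t <= g t) -> l <= l'.
Proof.
move=> fl gl fg; rewrite -subr_ge0; apply: cvgr_to_ge (cvgB gl fl) _.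
by apply: filterS fg => t; rewrite !fctE subr_ge0.
Qed.

(** Used to build an invariant mean and to extract limit kernels. In both cases one filter must give
    limits for all sets, respectively all points, at once; an ultrafilter does so without a diagonal
    argument. *)
Lemma ultra_bounded_cvg {R : realType} {T : Type} (F : set_system T) (a : T -> R)
    (l h : R) : UltraFilter F -> (forall t, l <= a t <= h) ->
  exists2 p, l <= p <= h & a @ F --> p.
Proof.
move=> FU alh; have aF : (a @ F) `[l, h]%classic.
  suff : F (a @^-1` `[l, h]%classic) by [].
  by apply: filterE => t; rewrite /= in_itv; exact: alh.
have [p []] := @segment_compact R l h (a @ F) (fmap_proper_filter _ _) aF.
rewrite /= in_itv /= => plh clp; exists p => // B pB.
have [//|FnB] := in_ultra_setVsetC (a @^-1` B) FU.
by have [x [nBx /nBx]] := clp (~` B) B FnB pB.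
Qed.

(** * Sums of finitely supported functions *)

Section FiniteSums.
Context {R : realType} {G : groupType}.
Implicit Types f h : G -> R.

Definition finsupp f := finite_set [set x | f x != 0].
Definition fsum f : R := \sum_(x \in [set: G]) f x.

Lemma finsupp_sub f h :
  (forall x, f x = 0 -> h x = 0) -> finsupp f -> finsupp h.
Proof.
move=> fh; apply: sub_finite_set => x /=.
by apply: contra_neq => /fh.
Qed.

Lemma finsupp_sub2 f1 f2 h : (forall x, f1 x = 0 -> f2 x = 0 -> h x = 0) ->
  finsupp f1 -> finsupp f2 -> finsupp h.
Proof.
move=> fh s1 s2; apply: (@sub_finite_set _ _
    ([set x | f1 x != 0] `|` [set x | f2 x != 0])).
  move=> x /= hx; apply/or_asboolP; rewrite !asboolb.
  by apply: contraNT hx; rewrite negb_or !negbK => /andP[/eqP a /eqP b]; rewrite fh.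
by rewrite finite_setU.
Qed.

Lemma finsupp_translate g f : finsupp f -> finsupp (fun x => f (g * x)%g).
Proof.
move=> fs; apply: (@sub_finite_set _ _
    ((fun y => (g^-1 * y)%g) @` [set x | f x != 0])).
  by move=> x /= fx; exists (g * x)%g => //; rewrite mulKg.
exact: finite_image.
Qed.

Lemma finsuppD f h : finsupp f -> finsupp h -> finsupp (fun x => f x + h x).
Proof. by apply: finsupp_sub2 => x -> ->; rewrite addr0. Qed.

Lemma finsuppZ c f : finsupp f -> finsupp (fun x => c * f x).
Proof. by apply: finsupp_sub => x ->; rewrite mulr0. Qed.

Lemma finsupp_sum (I : Type) (r : seq I) (F : I -> G -> R) :
  (forall i, finsupp (F i)) -> finsupp (fun x => \sum_(i <- r) F i x).
Proof.
move=> Fi; elim: r => [|i r IH].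
  apply: (@sub_finite_set _ _ set0) => // x /=.
  by rewrite big_nil eqxx.
by under [fun x : G => _]eq_fun => x do rewrite big_cons; apply: finsuppD.
Qed.

Lemma fsumD f h : finsupp f -> finsupp h ->
  fsum (fun x => f x + h x) = fsum f + fsum h.
Proof.
move=> fs hs; set P := [set x | f x != 0] `|` [set x | h x != 0].
have Pfin : finite_set P by rewrite finite_setU.
have E k : (forall x, ~ P x -> k x = 0) -> fsum k = \sum_(x \in P) k x.
  move=> kP; rewrite /fsum; apply/esym/fsbig_widen => // x [_ nP] /=.
  exact: kP.
have P0 x : ~ P x -> f x = 0 /\ h x = 0.
  by move=> nP; split; apply: contra_notP nP => /eqP; [left|right].
by rewrite !E ?fsbig_split// => x /P0[fx hx]; rewrite ?fx ?hx ?addr0.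
Qed.

Lemma fsumZ c f : fsum (fun x => c * f x) = c * fsum f.
Proof. by rewrite /fsum mulr_fsumr. Qed.

Lemma fsum_ge0 f : (forall x, 0 <= f x) -> 0 <= fsum f.
Proof. by move=> f0; apply: fsumr_ge0. Qed.

Lemma fsum_le f h : finsupp f -> finsupp h -> (forall x, f x <= h x) ->
  fsum f <= fsum h.
Proof.
move=> fs hs fh; rewrite -subr_ge0 -mulN1r -fsumZ -fsumD//; last exact: finsuppZ.
by apply: fsum_ge0 => x; rewrite mulN1r subr_ge0.
Qed.

Lemma fsum_translate g f : fsum (fun x => f (g * x)%g) = fsum f.
Proof.
rewrite /fsum [RHS](reindex_fsbigT (fun x => (g * x)%g))//.
by exists (fun x => (g^-1 * x)%g) => x; rewrite ?mulKg ?mulVKg.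
Qed.

Lemma fsum_sum (I : Type) (r : seq I) (F : I -> G -> R) :
  (forall i, finsupp (F i)) ->
  fsum (fun x => \sum_(i <- r) F i x) = \sum_(i <- r) fsum (F i).
Proof.
move=> Fi; elim: r => [|i r IH].
  rewrite big_nil; rewrite /fsum fsbig1// => x _; exact: big_nil.
under [fun x : G => _]eq_fun => x do rewrite big_cons.
by rewrite big_cons fsumD ?IH//; exact: finsupp_sum.
Qed.

Lemma fsum_ge f x : finsupp f -> (forall x, 0 <= f x) -> f x <= fsum f.
Proof.
move=> fs f0; have -> : f x = \sum_(y \in [set x]) f y by rewrite fsbig_set1.
rewrite [leLHS]fsbig_mkcond; apply: fsum_le => //.
  apply: finsupp_sub fs => y fy; rewrite /patch; by case: ifP.
by move=> y; rewrite /patch; case: ifP.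
Qed.

End FiniteSums.

(** * Loss of l2 norm and almost invariant functions *)

Section Kesten.
Context {R : realType} {G : groupType}.
Implicit Types (f : G -> R) (V : seq (G * R)).

(* A finitely supported measure is a list of weighted group elements, possibly
   with repetitions. *)
Definition weighted_prob V :=
  (forall a, a \in V -> 0 <= a.2) /\ \sum_(a <- V) a.2 = 1.

Definition lconv V f : G -> R := fun z => \sum_(a <- V) a.2 * f (a.1^-1 * z)%g.

Definition sq f : G -> R := fun x => f x ^+ 2.

Lemma finsupp_sq f : finsupp f -> finsupp (sq f).
Proof. by apply: finsupp_sub => x; rewrite /sq => ->; rewrite expr0n. Qed.

Lemma finsupp_lconv V f : finsupp f -> finsupp (lconv V f).
Proof.
by move=> fs; apply: finsupp_sum => a; apply/finsuppZ/finsupp_translate.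
Qed.

Lemma lconv_ge0 V f : weighted_prob V -> (forall x, 0 <= f x) ->
  forall x, 0 <= lconv V f x.
Proof.
by move=> [V0 _] f0 x; rewrite /lconv big_seq; apply: sumr_ge0 => a /V0 a0; rewrite mulr_ge0.
Qed.

Lemma weighted_variance V (phi : G -> R) : weighted_prob V ->
  \sum_(a <- V) a.2 * phi a.1 ^+ 2 - (\sum_(a <- V) a.2 * phi a.1) ^+ 2 =
  \sum_(a <- V) a.2 * (phi a.1 - \sum_(b <- V) b.2 * phi b.1) ^+ 2.
Proof.
move=> [_ V1]; set m := \sum_(b <- V) b.2 * phi b.1.
under [RHS]eq_bigr => a _.
  have -> : a.2 * (phi a.1 - m) ^+ 2 =
    a.2 * phi a.1 ^+ 2 - (2 * m) * (a.2 * phi a.1) + m ^+ 2 * a.2 by ring.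
  over.
rewrite big_split sumrB/= -!mulr_sumr V1 -/m; ring.
Qed.

(** An atom of weight w deviates from the mean by at most Var / w in square. Both s and 1 are atoms,
    and (a - b)^2 <= 2 (a - m)^2 + 2 (b - m)^2; the atom at 1 is what brings in [f z] itself. *)
Lemma variance_translate V f s ws w1 : weighted_prob V ->
  (s, ws) \in V -> (1%g, w1) \in V -> 0 < ws -> 0 < w1 -> forall z,
  (f (s^-1 * z)%g - f z) ^+ 2 <= (2 / ws + 2 / w1) *
   (\sum_(a <- V) a.2 * sq f (a.1^-1 * z)%g - sq (lconv V f) z).
Proof.
move=> Vp sV eV ws0 w10 z; rewrite /sq /lconv.
rewrite (@weighted_variance V (fun x => f (x^-1 * z)%g))//=.
pose m := \sum_(b <- V) b.2 * f (b.1^-1 * z)%g; rewrite -/m.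
pose Var := \sum_(a <- V) a.2 * (f (a.1^-1 * z)%g - m) ^+ 2; rewrite -/Var.
have [V0 _] := Vp.
have le a : a \in V -> a.2 * (f (a.1^-1 * z)%g - m) ^+ 2 <= Var.
  move=> aV; rewrite /Var (big_rem a)//= lerDl big_seq sumr_ge0// => b.
  by move=> /mem_rem /V0 b0; rewrite mulr_ge0 ?sqr_ge0.
have := le _ sV; have := le _ eV; rewrite /= invg1 mul1g => h1 h2.
have {}h1 : (f z - m) ^+ 2 <= Var / w1 by rewrite ler_pdivlMr// mulrC.
have {}h2 : (f (s^-1 * z)%g - m) ^+ 2 <= Var / ws by rewrite ler_pdivlMr// mulrC.
have := sqr_ge0 ((f (s^-1 * z)%g - m) + (f z - m)).
have -> : (2 / ws + 2 / w1) * Var = 2 * (Var / ws) + 2 * (Var / w1) by ring.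
nra.
Qed.

Lemma fsum_variance V f : weighted_prob V -> finsupp f ->
  fsum (fun z => \sum_(a <- V) a.2 * sq f (a.1^-1 * z)%g - sq (lconv V f) z) =
  fsum (sq f) - fsum (sq (lconv V f)).
Proof.
move=> [_ V1] fs; have fq := finsupp_sq fs.
rewrite fsumD; first last.
- apply: finsupp_sub (finsupp_sq (finsupp_lconv V fs)) => x ->; exact: oppr0.
- by apply: finsupp_sum => a; apply/finsuppZ/finsupp_translate.
under [fun x => - _]eq_fun => x do rewrite -mulN1r.
rewrite fsumZ mulN1r fsum_sum; last by move=> a; apply/finsuppZ/finsupp_translate.
congr (_ - _); under eq_bigr => a _ do rewrite fsumZ fsum_translate.
by rewrite -mulr_suml V1 mul1r.
Qed.

(** The loss of squared norm under averaging is the variance summed over the group, so a function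
    that loses little is almost fixed by each atom. *)
Lemma almost_invariant V f s ws w1 : weighted_prob V -> finsupp f ->
  (s, ws) \in V -> (1%g, w1) \in V -> 0 < ws -> 0 < w1 ->
  fsum (fun z => (f (s^-1 * z)%g - f z) ^+ 2) <=
  (2 / ws + 2 / w1) * (fsum (sq f) - fsum (sq (lconv V f))).
Proof.
move=> Vp fs sV eV ws0 w10; rewrite -fsum_variance// -fsumZ.
have fq := finsupp_sq fs.
apply: fsum_le; last by move=> x; exact: variance_translate.
  apply: finsupp_sub2 (finsupp_translate s^-1%g fs) fs => x -> ->.
  by rewrite subr0 expr0n.
apply/finsuppZ/finsuppD.
  by apply: finsupp_sum => a; apply/finsuppZ/finsupp_translate.
apply: finsupp_sub (finsupp_sq (finsupp_lconv V fs)) => x ->; exact: oppr0.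
Qed.

End Kesten.

Lemma young_weighted {R : realFieldType} (t u v : R) : 0 < t ->
  u * v <= t * u ^+ 2 / 2 + t^-1 * v ^+ 2 / 2.
Proof.
move=> t0; have tv : 0 < t^-1 by rewrite invr_gt0.
have := ler_wpM2l (ltW tv) (sqr_ge0 (t * u - v)); rewrite mulr0.
have -> : t^-1 * (t * u - v) ^+ 2 = t * u ^+ 2 - 2 * u * v + t^-1 * v ^+ 2.
  by field; rewrite gt_eqF.
by move=> h; lra.
Qed.

(** A pointwise substitute for the Cauchy-Schwarz inequality; t stays free in order to balance the
    two terms after summation. *)
Lemma sqr_diff_young {R : realFieldType} (t u v : R) : 0 < t ->
  `|u ^+ 2 - v ^+ 2| <= t * (u - v) ^+ 2 + (t^-1 * u ^+ 2 + t^-1 * v ^+ 2).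
Proof.
move=> t0; have tv : 0 < t^-1 by rewrite invr_gt0.
have h1 : 0 <= t * (u - v) ^+ 2 by rewrite mulr_ge0 ?sqr_ge0// ltW.
have h2 : 0 <= t^-1 * (u - v) ^+ 2 by rewrite mulr_ge0 ?sqr_ge0// ltW.
have h3 : 0 <= t^-1 * (u + v) ^+ 2 by rewrite mulr_ge0 ?sqr_ge0// ltW.
have := young_weighted (u - v) (u + v) t0.
have := young_weighted (v - u) (u + v) t0.
by rewrite ler_norml => ? ?; apply/andP; split; nra.
Qed.

Section KestenBound.
Context {R : realType} {G : groupType}.
Implicit Types (f : G -> R) (V W : seq (G * R)).

Definition mass_in (A : set G) f : R := fsum (fun x => (x \in A)%:R * sq f x).

Lemma finsupp_mass (A : set G) f :
  finsupp f -> finsupp (fun x => (x \in A)%:R * sq f x).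
Proof. by apply: finsupp_sub => x; rewrite /sq => ->; rewrite expr0n mulr0. Qed.

Lemma mass_in_translate (A : set G) f g :
  mass_in [set (g * x)%g | x in A] f = mass_in A (fun x => f (g * x)%g).
Proof.
rewrite /mass_in -(fsum_translate g); congr fsum; apply/funext => x /=.
congr (_%:R * _); congr nat_of_bool; apply/idP/idP; rewrite !inE.
  by case=> y Ay /mulgI <-.
by move=> Ax; exists x.
Qed.

(** With t = n + 1 in [sqr_diff_young], the displacement term sums to t * C / t^2 and the remaining
    two to 2 / t, whence C + 2. *)
Lemma mass_in_diff (A : set G) f g C n : finsupp f ->
  fsum (fun z => (f (g * z)%g - f z) ^+ 2) <=
    C * ((n.+1%:R ^+ 2)^-1 * fsum (sq f)) ->
  `|mass_in [set (g * x)%g | x in A] f - mass_in A f| <=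
    (C + 2) / n.+1%:R * fsum (sq f).
Proof.
move=> fs; rewrite mass_in_translate; set t : R := n.+1%:R => fC.
have t0 : 0 < t by rewrite ltr0n.
set fg := fun x => f (g * x)%g.
have fgs : finsupp fg by exact: finsupp_translate.
have ds : finsupp (fun z => (fg z - f z) ^+ 2).
  by apply: finsupp_sub2 fgs fs => x -> ->; rewrite subr0 expr0n.
pose b z := t * (fg z - f z) ^+ 2 + (t^-1 * sq fg z + t^-1 * sq f z).
have bs : finsupp b.
  apply: finsuppD; first exact: finsuppZ.
  by apply: finsuppD; apply/finsuppZ/finsupp_sq.
have sumb : fsum b <= (C + 2) / t * fsum (sq f).
  have s1 : finsupp (fun z => t * (fg z - f z) ^+ 2) by exact: finsuppZ.
  have s2 : finsupp (fun z => t^-1 * sq fg z) by exact/finsuppZ/finsupp_sq.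
  have s3 : finsupp (fun z => t^-1 * sq f z) by exact/finsuppZ/finsupp_sq.
  rewrite /b (fsumD s1 (finsuppD s2 s3)) (fsumD s2 s3).
  have -> : fsum (fun x => t^-1 * sq fg x) = t^-1 * fsum (sq f).
    by rewrite fsumZ; congr (_ * _); exact: (fsum_translate g (sq f)).
  rewrite !fsumZ; have := ler_wpM2l (ltW t0) fC.
  have -> : t * (C * ((t ^+ 2)^-1 * fsum (sq f))) = C / t * fsum (sq f).
    by field; rewrite gt_eqF.
  move=> h; apply: (le_trans (lerD h (lexx _))).
  by rewrite le_eqVlt; apply/orP; left; apply/eqP; ring.
have pt x : `|sq fg x - sq f x| <= b x.
  exact: sqr_diff_young.
have half h k : finsupp h -> finsupp k ->
    (forall x, `|sq h x - sq k x| <= b x) -> mass_in A h - mass_in A k <= fsum b.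
  move=> hs ks hk; rewrite lerBlDr -fsumD//; last exact: finsupp_mass.
  apply: fsum_le; first exact: finsupp_mass.
    by apply: finsuppD => //; exact: finsupp_mass.
  move=> x; case: (x \in A); rewrite ?mul0r ?mul1r ?addr0.
    by rewrite -lerBlDr (le_trans _ (hk x)) // ler_norm.
  by rewrite (le_trans _ (hk x)) // normr_ge0.
apply: le_trans sumb; rewrite ler_norml lerNl opprB; apply/andP; split; apply: half => // x.
by rewrite distrC.
Qed.

(** Otherwise each factor 1 - 1/(n+1)^2 is violated by some f_n. These functions are almost
    invariant, and an ultralimit of the probability densities proportional to f_n^2 is an invariant
    mean. The square in 1/(n+1)^2 is the rate that [mass_in_diff] converts into 1/(n+1). *)
Lemma lconv_contraction (S : set G) V : finite_symmetric_generating S ->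
  ~ amenable R G -> weighted_prob V ->
  (exists2 w1, 0 < w1 & (1%g, w1) \in V) ->
  (forall s, S s -> exists2 ws, 0 < ws & (s, ws) \in V) ->
  exists2 theta : R, 0 <= theta < 1 &
    forall f, finsupp f -> fsum (sq (lconv V f)) <= theta * fsum (sq f).
Proof.
move=> genS namen Vp [w1 w10 eV] SV; apply: contrapT => nth.
have fP (n : nat) : exists f, finsupp f /\
    (1 - (n.+1%:R ^+ 2)^-1) * fsum (sq f) < fsum (sq (lconv V f)).
  apply: contrapT => nf; apply: nth; exists (1 - (n.+1%:R ^+ 2)^-1).
    rewrite subr_ge0 invf_le1 ?exprn_gt0 ?ltr0n// ltrBlDr ltrDl invr_gt0.
    by rewrite exprn_gt0 ?ltr0n// andbT exprn_ege1// ler1n.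
  by move=> f fs; rewrite leNgt; apply/negP => ff; apply: nf; exists f.
have [f_ f_P] := choice fP.
pose N n := fsum (sq (f_ n)).
have inv n s ws : (s, ws) \in V -> 0 < ws ->
    fsum (fun z => (f_ n (s^-1 * z)%g - f_ n z) ^+ 2) <=
    (2 / ws + 2 / w1) * ((n.+1%:R ^+ 2)^-1 * N n).
  move=> sV ws0; have [fs fN] := f_P n.
  have := @almost_invariant _ _ V (f_ n) s ws w1 Vp fs sV eV ws0 w10.
  move/le_trans; apply; apply: ler_wpM2l.
    by rewrite addr_ge0// mulr_ge0// invr_ge0 ltW.
  by move: fN; rewrite mulrBl mul1r ltrBlDr -ltrBlDl => /ltW.
(* If the norm were 0, the strict inequality in [f_P] would make the norm after convolution
   positive, although the loss of norm is nonnegative. *)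
have N0 n : 0 < N n.
  have [fs fN] := f_P n.
  have N0 : 0 <= N n by apply: fsum_ge0 => x; exact: sqr_ge0.
  have := inv n _ _ eV w10; have := @almost_invariant _ _ V (f_ n) _ _ w1 Vp fs eV eV w10 w10.
  rewrite -/(N n) => h _; rewrite lt_neqAle N0 andbT; apply/eqP => N0e.
  have : 0 <= (2 / w1 + 2 / w1) * (N n - fsum (sq (lconv V (f_ n)))).
    by apply: le_trans h; apply: fsum_ge0 => x; exact: sqr_ge0.
  rewrite pmulr_rge0; last by rewrite addr_gt0// divr_gt0.
  move: fN; rewrite -/(N n) -N0e mulr0 sub0r oppr_ge0 => /lt_le_trans lt0 /lt0.
  by rewrite ltxx.
pose m_ n A := mass_in A (f_ n) / N n.
have [U [UU Uoo]] := ultraFilterLemma (eventually_filter : ProperFilter \oo).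
have mP A : exists m : R, 0 <= m <= 1 /\ m_ n A @[n --> U] --> m.
  have [|m m01 mcvg] := @ultra_bounded_cvg R _ U (m_ ^~ A) 0 1 UU; last by exists m.
  move=> n; rewrite /m_ ler_pdivlMr// mul0r ler_pdivrMr// mul1r.
  have [fs _] := f_P n; apply/andP; split.
    by apply: fsum_ge0 => x; rewrite mulr_ge0 ?sqr_ge0.
  apply: fsum_le; [exact: finsupp_mass | exact: finsupp_sq|] => x.
  by rewrite ler_piMl ?sqr_ge0// lern1 leq_b1.
have [m mE] := choice mP.
have uniq A l : m_ n A @[n --> U] --> l -> l = m A.
  by move=> cl; apply: cvg_unique cl (mE A).2; exact: Rhausdorff.
have mgen s A : S s -> m [set (s * x)%g | x in A] = m A.
  move=> Ss; have [_ Sinv _] := genS; have [ws ws0 sV] := SV _ (Sinv _ Ss).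
  have c1 := (mE [set (s * x)%g | x in A]).2; have c2 := (mE A).2.
  apply/eqP; rewrite -subr_eq0 -normr_le0.
  have FU : Filter U by exact: _.
  have cd := @cvg_norm _ _ _ _ FU _ _ (@cvgB _ _ _ _ FU _ _ _ _ c1 c2).
  pose C : R := 2 / ws + 2 / w1.
  have ch : (C + 2) * n.+1%:R^-1 @[n --> U] --> (0 : R).
    rewrite -(mulr0 (C + 2)); apply: cvgMl_tmp.
    by apply: cvg_trans (cvg_app _ Uoo) (@cvg_harmonic R).
  apply: cvg_le cd ch _; apply: nearW => n /=; rewrite !fctE.
  rewrite /m_ -mulrBl normrM [X in _ * X]gtr0_norm ?invr_gt0// ler_pdivrMr//.
  have [fs _] := f_P n; apply: mass_in_diff => //.
  by have := inv n _ _ sV ws0; rewrite invgK.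
apply: namen; exists m; split.
- by move=> A; have [/andP[]] := mE A.
- apply/esym/uniq; have -> : m_ ^~ setT = cst 1; last exact: cvg_cst.
  apply/funext => n; rewrite /m_ /mass_in.
  have -> : (fun x => (x \in setT)%:R * sq (f_ n) x) = sq (f_ n).
    by apply/funext => x; rewrite in_setT mul1r.
  by apply: divff; rewrite gt_eqF// N0.
- move=> A B AB0; apply/esym/uniq.
  have -> : m_ ^~ (A `|` B) = (fun n => m_ n A + m_ n B).
    apply/funext => n; rewrite /m_ -mulrDl; congr (_ / _).
    have [fs _] := f_P n.
    rewrite /mass_in -fsumD; [|exact: finsupp_mass..].
    congr fsum; apply/funext => x; rewrite -mulrDl; congr (_ * _).
    rewrite in_setU; have : ~ (x \in A /\ x \in B).
      by rewrite !inE => -[Ax Bx]; have : (A `&` B) x by []; rewrite AB0.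
    by case: (x \in A) (x \in B) => -[]//= h; rewrite ?addr0 ?add0r//; exfalso; apply: h.
  exact: cvgD (mE A).2 (mE B).2.
- move=> g A; have [_ _ /(_ g)[w wS <-]] := genS.
  elim: w wS A => [|s w IH] wS A.
    by rewrite big_nil; congr m; under eq_imagel do rewrite mul1g; rewrite image_id.
  rewrite big_cons -[RHS]IH; last by move=> t tw; apply: wS; rewrite /= inE tw orbT.
  rewrite -[RHS](@mgen s); last by apply: wS; rewrite /= inE eqxx.
  rewrite image_comp; congr m; apply: eq_imagel => x _ /=; by rewrite mulgA.
Qed.

End KestenBound.

(** * Exponential decay of convolution powers *)

Section ConvolutionPowers.
Context {R : realType} {G : groupType}.
Implicit Types (f : G -> R) (V W : seq (G * R)).

Definition dirac1 : G -> R := fun x => (x == 1%g)%:R.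

Definition cpow W n : G -> R := iter n (lconv W) dirac1.

Lemma finsupp_dirac1 : finsupp dirac1.
Proof.
apply: (@sub_finite_set _ _ [set 1%g]); last exact: finite_set1.
by move=> x /=; rewrite /dirac1; case: (x =P 1%g) => // _; rewrite eqxx.
Qed.

Lemma cpow_ge0 W n x : weighted_prob W -> 0 <= cpow W n x.
Proof.
by move=> Wp; elim: n x => [|n IH] x; [rewrite /= /dirac1 | exact: lconv_ge0].
Qed.

Lemma finsupp_cpow W n : finsupp (cpow W n).
Proof. by elim: n => [|n IH]; [exact: finsupp_dirac1 | exact: finsupp_lconv]. Qed.

Lemma lconv_le W f h : weighted_prob W -> (forall x, f x <= h x) ->
  forall x, lconv W f x <= lconv W h x.
Proof.
move=> [W0 _] fh x; rewrite /lconv !big_seq; apply: ler_sum => a /W0 a0.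
by rewrite ler_wpM2l.
Qed.

Lemma lconvZ W c f x : lconv W (fun x => c * f x) x = c * lconv W f x.
Proof. by rewrite /lconv mulr_sumr; apply: eq_bigr => a _; rewrite mulrCA. Qed.

Lemma lconv_cst W c x : weighted_prob W -> lconv W (fun=> c) x = c.
Proof. by move=> [_ W1]; rewrite /lconv -mulr_suml W1 mul1r. Qed.

(** The k-step measure as a single weighted list, so that the contraction, which asks for atoms at 1
    and at every generator, can be applied to k steps at once. *)
Fixpoint wpow W k : seq (G * R) :=
  if k is k'.+1 then
    [seq ((a.1 * b.1)%g, a.2 * b.2) | a <- W, b <- wpow W k']
  else [:: (1%g, 1)].

Lemma lconv_wpow W k f : lconv (wpow W k) f = iter k (lconv W) f.
Proof.
elim: k f => [|k IH] f; apply/funext => z.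
  by rewrite /lconv big_seq1 /= mul1r invg1 mul1g.
rewrite /= -IH /lconv /= big_allpairs_dep; apply: eq_bigr => a _.
rewrite mulr_sumr; apply: eq_bigr => b _ /=.
by rewrite invgM -mulgA mulrA.
Qed.

Lemma weighted_prob_wpow W k : weighted_prob W -> weighted_prob (wpow W k).
Proof.
move=> [W0 W1]; elim: k => [|k [V0 V1]] /=.
  by split=> [a|]; [rewrite inE => /eqP -> | rewrite big_seq1].
split=> [a /allpairsP[[b c] /= [/W0 b0 /V0 c0 ->]]|]; first exact: mulr_ge0.
rewrite big_allpairs_dep /=; under eq_bigr do rewrite -mulr_sumr V1 mulr1.
exact: W1.
Qed.

Lemma iter_lconv_bound W n f B : weighted_prob W -> (forall x, f x <= B) ->
  forall x, iter n (lconv W) f x <= B.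
Proof.
move=> Wp; elim: n f => [//|n IH] f fB x /=; rewrite -(lconv_cst B x Wp).
by apply: lconv_le => // y; exact: IH.
Qed.

Lemma wpow_mass W k s : weighted_prob W -> 0 < cpow W k s ->
  exists2 w, 0 < w & (s, w) \in wpow W k.
Proof.
move=> Wp; rewrite /cpow -lconv_wpow; have [V0 _] := weighted_prob_wpow k Wp.
move=> pos; apply: contrapT => nex; move: pos; rewrite ltNge => /negP; apply.
rewrite /lconv big_seq; apply: sumr_le0 => -[g w] /= gV; rewrite /dirac1.
case: eqP => [/mulg1_eq|_]; last by rewrite mulr0.
rewrite invgK => gs; rewrite mulr1 leNgt; apply/negP => w0.
by apply: nex; exists w => //; rewrite -gs.
Qed.

Lemma bernoulli_le (x : R) k : 0 <= x <= 1 -> 1 - k%:R * x <= (1 - x) ^+ k.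
Proof.
move=> /andP[x0 x1]; elim: k => [|k IH]; first by rewrite mul0r subr0 expr0.
have x10 : 0 <= 1 - x by rewrite subr_ge0.
rewrite exprS (le_trans _ (ler_wpM2l x10 IH))// -natr1.
by have := mulr_ge0 (ler0n R k) (sqr_ge0 x); nra.
Qed.

Lemma cpow_decay (S : set G) W k : finite_symmetric_generating S ->
  ~ amenable R G -> weighted_prob W -> (0 < k)%N -> 0 < cpow W k 1%g ->
  (forall s, S s -> 0 < cpow W k s) ->
  exists C theta : R, [/\ 0 < C, 0 < theta, theta < 1 &
    forall n x, cpow W n x <= C * theta ^+ n].
Proof.
move=> genS namen Wp k0 k1 kS.
have Vp := weighted_prob_wpow k Wp.
have [th /andP[th0 th1] thP] := lconv_contraction genS namen Vp (wpow_mass Wp k1)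
  (fun s Ss => wpow_mass Wp (kS s Ss)).
(* An upper bound for the square root of th that is still below 1; th contracts squared norms, t0
   therefore norms. *)
pose t0 := (1 + th) / 2.
have t00 : 0 < t0 by rewrite /t0; lra.
have t01 : t0 < 1 by rewrite /t0; lra.
have t0ge := ltW t00.
have t0th : th <= t0 ^+ 2 by rewrite /t0; have := sqr_ge0 (1 - th); nra.
have cpowD m n : cpow W (m + n) = iter m (lconv W) (cpow W n).
  by rewrite /cpow iterD.
have decay n : fsum (sq (cpow W (n * k))) <= th ^+ n.
  elim: n => [|n IH].
    rewrite expr0 /cpow /= /sq /dirac1 /fsum.
    rewrite -(fsbig_widen [set 1%g])//; first by rewrite fsbig_set1 eqxx expr1n.
    by move=> x [_ /= /eqP/negbTE ->]; rewrite expr0n.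
  rewrite mulSn cpowD -lconv_wpow exprS.
  by apply: (le_trans (thP _ (finsupp_cpow W (n * k)))); exact: ler_wpM2l.
have decayk n x : cpow W (n * k) x <= t0 ^+ n.
  rewrite -(@ler_pXn2r _ 2)// ?nnegrE ?cpow_ge0 ?exprn_ge0//.
  have sq0 y : 0 <= sq (cpow W (n * k)) y by exact: sqr_ge0.
  apply: (le_trans (fsum_ge x (finsupp_sq (finsupp_cpow W (n * k))) sq0)).
  apply: (le_trans (decay n)); rewrite exprAC.
  by apply: lerXn2r; rewrite ?nnegrE ?exprn_ge0.
have kR : 0 < k%:R :> R by rewrite ltr0n.
(* By Bernoulli's inequality (1 - x)^k >= t0, so 1 - x stands in for a k-th root of t0. The constant
   (1 - x)^-k chosen below absorbs the remainder n %% k. *)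
pose x := (1 - t0) / k%:R; have x01 : 0 < x <= 1 - t0.
  rewrite /x divr_gt0 ?subr_gt0//= ler_pdivrMr// ler_peMr ?subr_ge0 ?(ltW t01)//.
  by rewrite ler1n.
have th' : t0 <= (1 - x) ^+ k.
  apply: le_trans (bernoulli_le k _); last by lra.
  by rewrite /x mulrC divfK ?gt_eqF//; lra.
have y0 : 0 < 1 - x by lra.
have y1 : 1 - x < 1 by lra.
have y0' := ltW y0; have y1' := ltW y1.
exists ((1 - x) ^- k), (1 - x); split=> //; first by rewrite invr_gt0 exprn_gt0.
move=> n z; rewrite mulrC ler_pdivlMr ?exprn_gt0// {1}(divn_eq n k) addnC cpowD.
have := iter_lconv_bound (n %% k) Wp (decayk (n %/ k)%N) z => h.
apply: (le_trans (ler_wpM2r (exprn_ge0 k y0') h)).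
apply: (@le_trans _ _ (((1 - x) ^+ k) ^+ (n %/ k) * (1 - x) ^+ k)).
  by rewrite ler_wpM2r ?exprn_ge0// lerXn2r// ?nnegrE ?exprn_ge0.
rewrite -exprM -exprD ler_wiXn2l// {1}(divn_eq n k) mulnC leq_add2l.
by rewrite ltnW// ltn_pmod.
Qed.

End ConvolutionPowers.

(** * Lazy walks *)

Section LazyWalk.
Context {R : realType} {G : groupType}.
Implicit Types (f : G -> R) (W : seq (G * R)).

Definition lazy W : seq (G * R) := (1%g, 2^-1) :: [seq (a.1, a.2 / 2) | a <- W].

Lemma weighted_prob_lazy W : weighted_prob W -> weighted_prob (lazy W).
Proof.
move=> [W0 W1]; split=> [a|].
  rewrite inE => /orP[/eqP -> /=|/mapP[b /W0 b0 ->]]; first by rewrite invr_ge0.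
  by rewrite /= divr_ge0.
by rewrite big_cons big_map -mulr_suml W1 /= mul1r; lra.
Qed.

Lemma lconv_lazy W f x : lconv (lazy W) f x = 2^-1 * f x + 2^-1 * lconv W f x.
Proof.
rewrite /lconv big_cons big_map /= invg1 mul1g mulr_sumr; congr (_ + _).
by apply: eq_bigr => a _; rewrite [a.2 / 2]mulrC -mulrA.
Qed.

Lemma cpow_lazy_ge W n x : weighted_prob W ->
  2^-1 ^+ n * cpow W n x <= cpow (lazy W) n x.
Proof.
move=> Wp; elim: n x => [|n IH] x; first by rewrite expr0 mul1r.
have l0 := cpow_ge0 n _ (weighted_prob_lazy Wp).
rewrite /= -/(cpow _ _) -/(cpow _ _) lconv_lazy exprS -mulrA.
have := lconv_le Wp IH x; rewrite lconvZ => h.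
have := l0 x; lra.
Qed.

(** Holding keeps positive mass positive, so a single exponent can serve 1 and all generators,
    whatever the period of the original walk. *)
Lemma cpow_lazy_gt0 W n m x : weighted_prob W -> (n <= m)%N ->
  0 < cpow W n x -> 0 < cpow (lazy W) m x.
Proof.
move=> Wp /subnK <- n0; elim: (m - n)%N => [|k IH].
  by apply: lt_le_trans (cpow_lazy_ge n x Wp); rewrite mulr_gt0// exprn_gt0// invr_gt0.
rewrite addSn /= -/(cpow _ _) lconv_lazy ltr_pwDl//; first by rewrite mulr_gt0// invr_gt0.
apply: mulr_ge0; first by rewrite invr_ge0.
apply: lconv_ge0 => // y; exact: cpow_ge0 (weighted_prob_lazy Wp).
Qed.

Lemma lazy_decay (S : set G) W : finite_symmetric_generating S ->
  ~ amenable R G -> weighted_prob W -> (forall x, exists n, 0 < cpow W n x) ->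
  exists C theta : R, [/\ 0 < C, 0 < theta, theta < 1 &
    forall n x, cpow (lazy W) n x <= C * theta ^+ n].
Proof.
move=> genS namen Wp irr.
have [n_ nP] := choice irr.
have [k kP] : exists k, forall s, s \in gens S -> (n_ s <= k)%N.
  elim: (gens S) => [|s r [k IH]]; first by exists 0%N.
  exists (maxn (n_ s) k) => t; rewrite inE => /orP[/eqP ->|/IH h].
    exact: leq_maxl.
  by rewrite (leq_trans h)// leq_maxr.
apply: (@cpow_decay _ _ S (lazy W) (maxn k 1)) => //.
- exact: weighted_prob_lazy.
- by rewrite leq_max orbT.
- apply: (@cpow_lazy_gt0 W 0) => //; by rewrite /cpow /dirac1 /= eqxx.
move=> s Ss; apply: (@cpow_lazy_gt0 W (n_ s)) => //.
by rewrite leq_max kP// mem_gens//; exact/mem_set.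
Qed.

End LazyWalk.

(** * Green functions of killed walks *)

Section Potentials.
Context {R : realType} {G : groupType} (W : seq (G * R)).
Hypothesis Wp : weighted_prob W.
Implicit Types (f u v : G -> R) (k A B : pred G).

Definition markov f : G -> R := fun x => \sum_(a <- W) a.2 * f (x * a.1)%g.

Lemma markov_le f h : (forall x, f x <= h x) -> forall x, markov f x <= markov h x.
Proof.
move=> fh x; rewrite /markov !big_seq; apply: ler_sum => a aW.
by rewrite ler_wpM2l//; case: Wp => + _; apply.
Qed.

Lemma markov_ge0 f : (forall x, 0 <= f x) -> forall x, 0 <= markov f x.
Proof.
move=> f0 x; rewrite /markov big_seq; apply: sumr_ge0 => a aW.
by rewrite mulr_ge0//; case: Wp => + _; apply.
Qed.

Lemma markovZ c f x : markov (fun x => c * f x) x = c * markov f x.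
Proof. by rewrite /markov mulr_sumr; apply: eq_bigr => a _; rewrite mulrCA. Qed.

Lemma markovD f h x : markov (fun x => f x + h x) x = markov f x + markov h x.
Proof. by rewrite /markov -big_split; apply: eq_bigr => a _; rewrite mulrDr. Qed.

Lemma markov_sum (I : Type) (r : seq I) (F : I -> G -> R) x :
  markov (fun x => \sum_(i <- r) F i x) x = \sum_(i <- r) markov (F i) x.
Proof.
rewrite /markov exchange_big; apply: eq_bigr => a _ /=.
by rewrite mulr_sumr.
Qed.

Lemma cvg_markov (T : Type) (F : set_system T) {FF : Filter F}
    (f_ : T -> G -> R) f x : (forall y, f_ t y @[t --> F] --> f y) ->
  markov (f_ t) x @[t --> F] --> markov f x.
Proof.
move=> fc; rewrite /markov; elim: W => [|a r IH].
  rewrite big_nil; under eq_cvg do rewrite big_nil; exact: cvg_cst.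
rewrite big_cons; under eq_cvg do rewrite big_cons.
by apply: cvgD => //; apply: cvgMl_tmp.
Qed.

(** The expected sum of f over the first N positions of the walk from x, stopped after its first
    position outside k. Green functions, killed Green functions and hitting probabilities are all of
    this form. *)
Fixpoint pot k f N x : R :=
  if N is N'.+1 then f x + (k x)%:R * markov (pot k f N') x else 0.

Definition Pot k f x : R := limn (fun N => pot k f N x).

Lemma pot_ge0 k f N x : (forall x, 0 <= f x) -> 0 <= pot k f N x.
Proof.
move=> f0; elim: N x => //= N IH x.
by rewrite addr_ge0// mulr_ge0// markov_ge0.
Qed.

Lemma pot_mono k f N x : (forall x, 0 <= f x) -> pot k f N x <= pot k f N.+1 x.
Proof.
move=> f0; elim: N x => [|N IH] x; first exact: pot_ge0.
by rewrite /= lerD2l ler_wpM2l//; apply: markov_le => y; exact: IH.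
Qed.

(** The existence of one such v makes [Pot k f] a finite limit, and [Pot k f] lies below all of
    them; upper bounds on potentials are thus proved by exhibiting a supersolution. *)
Definition supersolution k f v :=
  (forall x, 0 <= v x) /\ forall x, f x + (k x)%:R * markov v x <= v x.

Lemma pot_le k f v N x : supersolution k f v -> pot k f N x <= v x.
Proof.
move=> [v0 fv]; elim: N x => //= N IH x; apply: le_trans (fv x).
by rewrite lerD2l ler_wpM2l//; apply: markov_le.
Qed.

Lemma pot_cvg k f v x : (forall x, 0 <= f x) -> supersolution k f v ->
  pot k f N x @[N --> \oo] --> Pot k f x.
Proof.
move=> f0 fv; apply: nondecreasing_is_cvgn.
  by apply/nondecreasing_seqP => n; exact: pot_mono.
by exists (v x) => _ [N _ <-]; exact: pot_le.
Qed.

Lemma Pot_le k f v x : (forall x, 0 <= f x) -> supersolution k f v ->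
  Pot k f x <= v x.
Proof.
move=> f0 fv; apply: cvgr_to_le (pot_cvg f0 fv) _.
by apply: nearW => N; exact: pot_le.
Qed.

Lemma pot_le_Pot k f v N x : (forall x, 0 <= f x) -> supersolution k f v ->
  pot k f N x <= Pot k f x.
Proof.
move=> f0 fv; apply: (@nondecreasing_cvgn_le _ (fun N => pot k f N x)).
  by apply/nondecreasing_seqP => n; exact: pot_mono.
exact/cvgP/(pot_cvg f0 fv).
Qed.

Lemma Pot_lub k f v M x : (forall x, 0 <= f x) -> supersolution k f v ->
  (forall N, pot k f N x <= M) -> Pot k f x <= M.
Proof.
by move=> f0 fv fM; apply: cvgr_to_le (pot_cvg f0 fv) _; apply: nearW.
Qed.

Lemma Pot_ge0 k f v x : (forall x, 0 <= f x) -> supersolution k f v ->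
  0 <= Pot k f x.
Proof. by move=> f0 fv; have := pot_le_Pot 0 x f0 fv. Qed.

Lemma Pot_fix k f v x : (forall x, 0 <= f x) -> supersolution k f v ->
  Pot k f x = f x + (k x)%:R * markov (Pot k f) x.
Proof.
move=> f0 fv; have c1 := @pot_cvg k f v x f0 fv; rewrite -(cvg_shiftS _) /= in c1.
have c2 : f x + (k x)%:R * markov (pot k f N) x @[N --> \oo] -->
    f x + (k x)%:R * markov (Pot k f) x.
  apply: cvgD; first exact: cvg_cst.
  by apply: cvgMl_tmp; apply: cvg_markov => y; exact: pot_cvg f0 fv.
by apply: (cvg_unique _ c1 c2); exact: Rhausdorff.
Qed.

Definition superharmonic u :=
  (forall x, 0 <= u x) /\ forall x, markov u x <= u x.

Definition source y : G -> R := fun x => (x == y)%:R.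

Lemma source_ge0 y x : 0 <= source y x. Proof. by []. Qed.

Lemma markov_pow_cpow n x y :
  iter n markov (source y) x = cpow W n (x^-1 * y)%g.
Proof.
elim: n x => [|n IH] x; rewrite /=.
  rewrite /source /dirac1; congr (_%:R); congr nat_of_bool.
  by apply/eqP/eqP => [->|/mulg1_eq]; rewrite ?mulVg// invgK.
by rewrite /cpow /= /lconv; apply: eq_bigr => a _; rewrite IH invgM -mulgA.
Qed.

Lemma iter_markov_ge0 n f : (forall x, 0 <= f x) -> forall x, 0 <= iter n markov f x.
Proof. by move=> f0; elim: n => // n IH x; exact: markov_ge0. Qed.

Lemma pot_powers f N x : pot predT f N x = \sum_(n < N) iter n markov f x.
Proof.
elim: N x => [|N IH] x; first by rewrite big_ord0.
rewrite big_ord_recl /= mul1r; congr (_ + _).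
rewrite -markov_sum.
by congr markov; apply/funext => y; rewrite IH.
Qed.

Lemma superharmonic_iter u n x : superharmonic u -> iter n markov u x <= u x.
Proof.
move=> [u0 uP]; elim: n x => //= n IH x.
by apply: le_trans (uP x); apply: markov_le.
Qed.

Lemma iter_markov_le n f h :
  (forall x, f x <= h x) -> forall x, iter n markov f x <= iter n markov h x.
Proof. by move=> fh; elim: n => // n IH x; exact: markov_le. Qed.

Lemma iter_markovZ n c f x :
  iter n markov (fun x => c * f x) x = c * iter n markov f x.
Proof.
elim: n x => //= n IH x; rewrite -markovZ; congr markov.
exact/funext.
Qed.

Lemma superharmonic_ge u n x y : superharmonic u ->
  cpow W n (x^-1 * y)%g * u y <= u x.
Proof.
move=> us; have [u0 _] := us; apply: le_trans (superharmonic_iter n x us).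
rewrite -markov_pow_cpow mulrC -iter_markovZ; apply: iter_markov_le => z.
by rewrite /source; case: eqP => [->|_]; rewrite ?mulr1// mulr0.
Qed.

Lemma cpow_mulr m n x y z :
  cpow W m (x^-1 * y)%g * cpow W n (y^-1 * z)%g <= cpow W (m + n) (x^-1 * z)%g.
Proof.
rewrite -!markov_pow_cpow iterD mulrC -iter_markovZ; apply: iter_markov_le => t.
rewrite /source; case: eqP => [->|_]; first by rewrite mulr1.
by rewrite mulr0 iter_markov_ge0// => u; exact: source_ge0.
Qed.

End Potentials.

(* The random walk, with the exponential decay and irreducibility that the lazy
   walk of a non-amenable group enjoys. *)
Record decaying_walk (R : realType) (G : groupType) (W : seq (G * R))
    (C theta : R) : Prop := DecayingWalk {
  walk_prob : weighted_prob W;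
  walk_C : 0 < C;
  walk_theta0 : 0 < theta;
  walk_theta1 : theta < 1;
  walk_decay : forall n x, cpow W n x <= C * theta ^+ n;
  walk_irr : forall x, exists n, 0 < cpow W n x }.

Section Green.
Context {R : realType} {G : groupType} (W : seq (G * R)) (C theta : R).
Hypothesis walk : decaying_walk W C theta.
Implicit Types (f u v : G -> R) (B : pred G).
Let Wp := walk_prob walk.
Local Notation markov := (markov W).
Local Notation pot := (pot W).
Local Notation Pot := (Pot W).
Local Notation superharmonic := (superharmonic W).

Definition gr (x y : G) : R := Pot predT (source y) x.

Definition green_bound : R := C / (1 - theta).

Lemma green_bound_gt0 : 0 < green_bound.
Proof.
by rewrite divr_gt0 ?subr_gt0 ?(walk_theta1 walk) ?(walk_C walk).
Qed.

Lemma tail_le m N x : \sum_(m <= n < N) cpow W n x <= green_bound * theta ^+ m.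
Proof.
have th0 := ltW (walk_theta0 walk); have th1 := walk_theta1 walk.
have C0 := walk_C walk; have th10 : 0 < 1 - theta by rewrite subr_gt0.
have h M : \sum_(0 <= n < M) theta ^+ n <= (1 - theta)^-1.
  rewrite -div1r ler_pdivlMr// mulrC.
  have <- : 1 - theta ^+ M = (1 - theta) * \sum_(0 <= i < M) theta ^+ i.
    rewrite -[in LHS](expr1n _ M) subrXX big_mkord; congr (_ * _).
    by apply: eq_bigr => i _; rewrite expr1n mul1r.
  by rewrite lerBlDr lerDl exprn_ge0.
apply: (@le_trans _ _ (\sum_(m <= n < N) C * theta ^+ n)).
  by apply: ler_sum => n _; exact: walk_decay walk n x.
case: (leqP m N) => [mN|Nm]; last first.
  by rewrite big_geq ?(ltnW Nm)// mulr_ge0 ?exprn_ge0// ltW// green_bound_gt0.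
rewrite -mulr_sumr /green_bound -mulrA ler_wpM2l ?(ltW C0)//.
rewrite -{1}(add0n m) big_addn.
under eq_bigr do rewrite exprD; rewrite -mulr_suml.
by rewrite ler_wpM2r ?exprn_ge0.
Qed.

Lemma pot_source N x y :
  pot predT (source y) N x = \sum_(0 <= n < N) cpow W n (x^-1 * y)%g.
Proof.
by rewrite pot_powers// big_mkord; apply: eq_bigr => n _; rewrite markov_pow_cpow.
Qed.

Lemma pot_source_bound N x y : pot predT (source y) N x <= green_bound.
Proof. by rewrite pot_source; have := tail_le 0 N (x^-1 * y)%g; rewrite expr0 mulr1. Qed.

Lemma green_cvg x y : pot predT (source y) N x @[N --> \oo] --> gr x y.
Proof.
apply: nondecreasing_is_cvgn.
  by apply/nondecreasing_seqP => n; apply: pot_mono => // z; exact: source_ge0.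
by exists green_bound => _ [N _ <-]; exact: pot_source_bound.
Qed.

Lemma gr_ge0 x y : 0 <= gr x y.
Proof.
apply: cvgr_to_ge (@green_cvg x y) _; apply: nearW => N.
by apply: pot_ge0 => // z; exact: source_ge0.
Qed.

Lemma gr_le_bound x y : gr x y <= green_bound.
Proof.
by apply: cvgr_to_le (@green_cvg x y) _; apply: nearW => N; exact: pot_source_bound.
Qed.

Lemma pot_le_gr N x y : pot predT (source y) N x <= gr x y.
Proof.
apply: (@nondecreasing_cvgn_le _ (fun N => pot predT (source y) N x)).
  by apply/nondecreasing_seqP => n; apply: pot_mono => // z; exact: source_ge0.
exact/cvgP/green_cvg.
Qed.

Lemma gr_fix x y : gr x y = source y x + markov (gr ^~ y) x.
Proof.
have c1 := @green_cvg x y; rewrite -(cvg_shiftS _) /= in c1.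
have c2 : source y x + true%:R * markov (pot predT (source y) N) x @[N --> \oo] -->
    source y x + true%:R * markov (gr ^~ y) x.
  apply: cvgD; first exact: cvg_cst.
  by apply: cvgMl_tmp; apply: cvg_markov => z; exact: green_cvg.
by rewrite -[markov _ _]mul1r; apply: (cvg_unique _ c1 c2); exact: Rhausdorff.
Qed.

Lemma gr_supersolution k f y : (forall x, f x <= source y x) ->
  supersolution W k f (gr ^~ y).
Proof.
move=> fy; split=> [x|x]; first exact: gr_ge0.
rewrite gr_fix; apply: lerD => //.
by rewrite ler_piMl ?lern1 ?leq_b1//; apply: markov_ge0 => // z; exact: gr_ge0.
Qed.

Lemma superharmonic_gr y : superharmonic (gr ^~ y).
Proof.
split=> x; first exact: gr_ge0.
by rewrite [leRHS]gr_fix lerDr source_ge0.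
Qed.

Lemma gr_gt0 x y : 0 < gr x y.
Proof.
have [n n0] := walk_irr walk (x^-1 * y)%g.
apply: lt_le_trans (pot_le_gr n.+1 x y); rewrite pot_source big_nat_recr//=.
by rewrite ltr_wpDl// sumr_ge0// => i _; exact: cpow_ge0.
Qed.

(* Green function of the walk killed on entering [B] *)
Definition ksource B y : G -> R := fun x => (~~ B x && (x == y))%:R.

Definition kgr B (x y : G) : R := Pot (predC B) (ksource B y) x.

Lemma ksource_ge0 B y x : 0 <= ksource B y x. Proof. by []. Qed.

Lemma ksource_le B y x : ksource B y x <= source y x.
Proof. by rewrite /ksource ler_nat; case: (B x); case: (x == y). Qed.

Lemma ksol B y : supersolution W (predC B) (ksource B y) (gr ^~ y).
Proof. by apply: gr_supersolution => x; exact: ksource_le. Qed.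

Lemma kgr_ge0 B x y : 0 <= kgr B x y.
Proof. exact: Pot_ge0 (ksource_ge0 B y) (ksol B y). Qed.

Lemma kgr_le B x y : kgr B x y <= gr x y.
Proof. exact: (Pot_le Wp x (ksource_ge0 B y) (ksol B y)). Qed.

Lemma kgr_fix B x y : kgr B x y = (~~ B x)%:R * (source y x + markov (kgr B ^~ y) x).
Proof.
rewrite /kgr (Pot_fix Wp x (ksource_ge0 B y) (ksol B y)) mulrDr.
congr (_ + _); rewrite /ksource /source /=.
by case: (B x); rewrite ?mul0r ?mul1r.
Qed.

Lemma kgr_end B x y : B y -> kgr B x y = 0.
Proof.
move=> By; apply/eqP; rewrite eq_le kgr_ge0 andbT.
apply: (@Pot_le _ _ _ Wp _ _ (fun=> 0)); first exact: ksource_ge0.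
split=> // z; rewrite /markov big1 ?mulr0 ?addr0 => [|a _]; last by rewrite mulr0.
by rewrite /ksource; case: eqP => [->|_]; rewrite ?By ?andbF.
Qed.

(* [hit B A x w] is the probability that the walk from [x] killed on [B] enters
   [A] for the first time at [w]. *)
Definition hsource B (A : seq G) w : G -> R :=
  fun x => [&& ~~ B x, x \in A & x == w]%:R.

Definition hit B (A : seq G) (x w : G) : R :=
  Pot (fun x => ~~ B x && (x \notin A)) (hsource B A w) x.

Lemma hsource_ge0 B A y x : 0 <= hsource B A y x. Proof. by []. Qed.

Lemma hsol B A w : supersolution W (fun x => ~~ B x && (x \notin A))
  (hsource B A w) (gr ^~ w).
Proof.
apply: gr_supersolution => x; rewrite /hsource ler_nat.
by case: (B x); case: (x \in A); case: (x == w).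
Qed.

Lemma hit_ge0 B A x w : 0 <= hit B A x w.
Proof. exact: Pot_ge0 (hsource_ge0 B A w) (hsol B A w). Qed.

Lemma hit_le B A x w : hit B A x w <= gr x w.
Proof. exact: (Pot_le Wp x (hsource_ge0 B A w) (hsol B A w)). Qed.

(* Optional stopping: [u] need only be superharmonic for the killed walk. *)
Lemma hit_superharmonic B A u x : uniq A -> (forall x, 0 <= u x) ->
  (forall x, (~~ B x)%:R * markov u x <= u x) ->
  \sum_(w <- A) hit B A x w * u w <= u x.
Proof.
move=> Au u0 uP; set k := fun x => ~~ B x && (x \notin A).
have lin N z : \sum_(w <- A) pot k (hsource B A w) N z * u w =
    pot k (fun x => \sum_(w <- A) hsource B A w x * u w) N z.
  elim: N z => [|N IH] z /=; first by rewrite big1// => i _; rewrite mul0r.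
  under eq_bigr do rewrite mulrDl; rewrite big_split/=; congr (_ + _).
  under eq_bigr do rewrite -mulrA; rewrite -mulr_sumr; congr (_ * _).
  transitivity (\sum_(i <- A) markov (fun y => u i * pot k (hsource B A i) N y) z).
    by apply: eq_bigr => i _; rewrite markovZ mulrC.
  rewrite -markov_sum; congr markov; apply/funext => y; rewrite -IH.
  by apply: eq_bigr => i _; rewrite mulrC.
have c r : \sum_(w <- r) pot k (hsource B A w) N x * u w @[N --> \oo] -->
    \sum_(w <- r) hit B A x w * u w.
  elim: r => [|w r IH].
    rewrite big_nil; under eq_cvg do rewrite big_nil; exact: cvg_cst.
  rewrite big_cons; under eq_cvg do rewrite big_cons.
  apply: cvgD => //; apply: cvgMr_tmp.
  exact: (pot_cvg Wp (hsource_ge0 B A w) (hsol B A w)).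
apply: cvgr_to_le (c A) _; apply: nearW => N; rewrite lin.
apply: pot_le => //; split=> // z; rewrite /k.
case Bz : (B z); have := uP z; rewrite Bz ?mul0r ?mul1r => h.
  by rewrite big1 ?addr0// => w _; rewrite /hsource Bz mul0r.
case Az : (z \in A) => /=; last first.
  by rewrite mul1r big1 ?add0r// => w _; rewrite /hsource Az andbF mul0r.
rewrite mul0r addr0 (bigD1_seq z)//= {1}/hsource Bz Az eqxx mul1r.
rewrite big1 ?addr0// => w wz; rewrite /hsource Bz Az /= eq_sym (negbTE wz).
by rewrite mul0r.
Qed.

(** First-entrance decomposition. The induction truncates the time before the entrance in A but
    keeps the full [kgr B w y] afterwards, which avoids a convolution over the entrance time. *)
Lemma kgr_decomp B A x y : kgr B x y <=
  \sum_(w <- A) hit B A x w * kgr B w y + kgr (fun z => B z || (z \in A)) x y.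
Proof.
pose BA : pred G := fun z => B z || (z \in A).
rewrite -[X in _ <= _ + X]/(kgr BA x y).
apply: (Pot_lub Wp (ksource_ge0 B y) (ksol B y)) => N.
apply: (@le_trans _ _ (\sum_(w <- A)
    pot (fun x => ~~ B x && (x \notin A)) (hsource B A w) N x * kgr B w y +
    pot (predC BA) (ksource BA y) N x)); last first.
  apply: lerD; last exact: (pot_le_Pot Wp _ _ (ksource_ge0 BA y) (ksol BA y)).
  apply: ler_sum => w _; rewrite ler_wpM2r ?kgr_ge0//.
  exact: (pot_le_Pot Wp _ _ (hsource_ge0 B A w) (hsol B A w)).
elim: N x => [|N IH] x.
  by rewrite /= addr0 sumr_ge0// => w _; rewrite mul0r.
have h0 w z M : 0 <= pot (fun x => ~~ B x && (x \notin A)) (hsource B A w) M z.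
  by apply: pot_ge0 => // t; exact: hsource_ge0.
have k0 z M : 0 <= pot (predC BA) (ksource BA y) M z.
  by apply: pot_ge0 => // t; exact: ksource_ge0.
case Bx : (B x).
  rewrite [leLHS]/= /ksource Bx mul0r addr0; apply: addr_ge0; last exact: k0.
  by apply: sumr_ge0 => w _; rewrite mulr_ge0 ?kgr_ge0.
case Ax : (x \in A).
  apply: (@le_trans _ _ (kgr B x y)).
    exact: (pot_le_Pot Wp _ _ (ksource_ge0 B y) (ksol B y)).
  rewrite (big_rem x)//= -addrA ler_wpDr//.
    apply: addr_ge0; last by have := k0 x N.+1.
    by apply: sumr_ge0 => w _; rewrite mulr_ge0 ?kgr_ge0//; have := h0 w x N.+1.
  by rewrite ler_peMl ?kgr_ge0// /hsource Bx Ax eqxx /= lerDl mul0r.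
rewrite /= /BA Bx Ax /= !mul1r /ksource /hsource Bx Ax /=.
under eq_bigr => w _ do rewrite add0r mul1r.
have := markov_le Wp IH x => h; rewrite addrCA lerD2l; apply: (le_trans h).
rewrite markovD lerD2r markov_sum; apply: ler_sum => w _.
rewrite le_eqVlt; apply/orP; left; apply/eqP; rewrite mulrC -markovZ; congr markov.
by apply/funext => z; rewrite mulrC.
Qed.

Lemma kgr_superharmonic B y x : (~~ B x)%:R * markov (kgr B ^~ y) x <= kgr B x y.
Proof. by rewrite [leRHS]kgr_fix mulrDr lerDr mulr_ge0// source_ge0. Qed.

(* Domination principle: the first visit to [a] accounts for [kgr B x a] up to
   the total mass of the returns. *)
Lemma kgr_mul_le B u x a : (forall x, 0 <= u x) ->
  (forall x, (~~ B x)%:R * markov u x <= u x) ->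
  kgr B x a * u a <= green_bound * u x.
Proof.
move=> u0 uP.
have := kgr_decomp B [:: a] x a; rewrite big_seq1 [X in _ + X]kgr_end ?inE ?eqxx ?orbT//.
rewrite addr0 => h; apply: (le_trans (ler_wpM2r (u0 a) h)).
have := @hit_superharmonic B [:: a] u x isT u0 uP; rewrite big_seq1 => h2.
have h3 : kgr B a a <= green_bound := le_trans (kgr_le B a a) (gr_le_bound a a).
rewrite mulrAC mulrC; apply: ler_pM => //; first exact: kgr_ge0.
by rewrite mulr_ge0// hit_ge0.
Qed.

Lemma kgr_pred0 x y : kgr pred0 x y = gr x y.
Proof. by []. Qed.

Lemma gr_mul_le u x a : superharmonic u -> gr x a * u a <= green_bound * u x.
Proof.
move=> [u0 uP]; rewrite -kgr_pred0; apply: kgr_mul_le => // z.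
by rewrite mul1r.
Qed.

Lemma gr_decomp A x y : gr x y <=
  \sum_(w <- A) hit pred0 A x w * gr w y + kgr (mem A) x y.
Proof.
have := kgr_decomp pred0 A x y; rewrite kgr_pred0.
by under eq_bigr do rewrite kgr_pred0.
Qed.

End Green.

(** * Harnack inequality and sums over paths *)

Section Harnack.
Context {R : realType} {G : groupType} (S : set G) (W : seq (G * R)) (C theta : R).
Hypothesis genS : finite_symmetric_generating S.
Hypothesis walk : decaying_walk W C theta.
Let Wp := walk_prob walk.
Local Notation dist := (word_dist S).
Local Notation gr := (gr W).

Lemma gr_mulr_step x y s n : gr x y * cpow W n s <= gr x (y * s)%g.
Proof.
have p0 := cpow_ge0 n s Wp.
have cg : pot W predT (source y) N x * cpow W n s @[N --> \oo] -->
    gr x y * cpow W n s by apply: cvgMr_tmp; exact: (@green_cvg _ _ _ _ _ walk x y).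
apply: cvgr_to_le cg _; apply: nearW => N; apply: le_trans (pot_le_gr walk (N + n) x (y * s)%g).
rewrite !pot_source mulr_suml.
apply: (@le_trans _ _ (\sum_(0 <= m < N) cpow W (m + n) (x^-1 * (y * s))%g)).
  apply: ler_sum => m _; have := cpow_mulr Wp m n x y (y * s)%g.
  by rewrite mulKg.
rewrite [leRHS](@big_cat_nat _ _ _ n)//=; last by rewrite leq_addl.
have -> : \sum_(n <= i < N + n) cpow W i (x^-1 * (y * s))%g =
    \sum_(0 <= i < N) cpow W (i + n) (x^-1 * (y * s))%g.
  by rewrite -{1}(add0n n) big_addn addnK.
rewrite ler_wpDl//.
by apply: sumr_ge0 => m _; exact: cpow_ge0.
Qed.

(** Superharmonicity concerns the first variable of G, and without symmetry the second needs its own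
    estimate, [gr_mulr_step]. Both cases reduce to a comparison across one generator, with c
    exceeding the inverse probability of reaching it, iterated along a shortest word. *)
Lemma harnack : exists2 c : R, 1 <= c &
  (forall u x x', superharmonic W u -> u x' <= c ^+ dist x x' * u x) /\
  (forall x y y', gr x y <= c ^+ dist y y' * gr x y').
Proof.
have [n_ nP] := choice (walk_irr walk).
have [c [c1 cP]] : exists c : R, 1 <= c /\
    forall s, s \in gens S -> 1 <= c * cpow W (n_ s) s.
  elim: (gens S) => [|s r [c [c1 cP]]]; first by exists 1.
  exists (c + (cpow W (n_ s) s)^-1); split.
    by rewrite ler_wpDr// invr_ge0 ltW// nP.
  move=> t; rewrite inE => /predU1P[->|/cP tP].
    rewrite mulrDl mulVf ?gt_eqF ?nP// lerDr mulr_ge0// ?cpow_ge0//.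
    exact: le_trans c1.
  rewrite mulrDl ler_wpDr// mulr_ge0 ?cpow_ge0// invr_ge0 ltW// nP.
have c0 : 0 <= c by exact: le_trans c1.
have words w x : [set` w] `<=` S -> forall v : G -> R, (forall z, 0 <= v z) ->
    (forall z s, s \in gens S -> v z <= c * v (z * s)%g) ->
    v x <= c ^+ size w * v (x * \prod_(s <- w) s)%g.
  move=> + v v0 vP; elim: w x => [|s w IH] x wS.
    by rewrite big_nil mulg1 expr0 mul1r.
  have sg : s \in gens S.
    by rewrite mem_gens//; apply/mem_set/wS; rewrite /= inE eqxx.
  rewrite big_cons mulgA exprS -mulrA; apply: (le_trans (vP x s sg)).
  by rewrite ler_wpM2l// IH// => t tw; apply: wS; rewrite /= inE tw orbT.
have main v : (forall z, 0 <= v z) ->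
    (forall z s, s \in gens S -> v z <= c * v (z * s)%g) ->
    forall x y, v x <= c ^+ dist x y * v y.
  move=> v0 vP x y; have [w [wS wg wn]] := word_normP genS (x^-1 * y)%g.
  rewrite /word_dist -wn; have := words w x wS v v0 vP.
  by rewrite wg mulVKg.
exists c => //; split.
  move=> u x x' us; have [u0 _] := us; rewrite dist_sym//; apply: main => // z s sg.
  have sVg : s^-1%g \in gens S.
    have [_ Sinv _] := genS; move: sg; rewrite !mem_gens// !inE; exact: Sinv.
  have := superharmonic_ge Wp (n_ s^-1%g) (z * s)%g z us.
  rewrite invgM -mulgA mulVg mulg1 => h; apply: le_trans (ler_wpM2l c0 h).
  by rewrite mulrA ler_peMl// cP.
move=> x y y'; apply: (main (gr x)) => [z|z s sg]; first exact: (gr_ge0 walk).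
apply: le_trans (ler_wpM2l c0 (gr_mulr_step x z s (n_ s))).
by rewrite mulrCA ler_peMr ?(gr_ge0 walk)// cP.
Qed.

Lemma cpow_far r n g : (forall a, a \in W -> (word_norm S a.1 <= r)%N) ->
  (n * r < word_norm S g)%N -> cpow W n g = 0.
Proof.
move=> Wr; elim: n g => [|n IH] g gn.
  rewrite /cpow /= /dirac1; case: eqP => // g1; move: gn.
  by rewrite g1 word_norm1.
rewrite /cpow /= /lconv big_seq big1// => a aW.
rewrite -/(cpow W n _) IH ?mulr0//; have := word_normM genS a.1 (a.1^-1 * g)%g.
rewrite mulVKg => tri; have aR := Wr _ aW.
rewrite -(ltn_add2l r); rewrite mulSn in gn; apply: (leq_trans gn).
by apply: (leq_trans tri); rewrite leq_add2r.
Qed.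

(** Fewer than m steps of length at most r cannot cover the distance, so only the tail of the Green
    series contributes. *)
Lemma gr_far r m x y : (forall a, a \in W -> (word_norm S a.1 <= r)%N) ->
  (m * r < dist x y)%N -> gr x y <= green_bound C theta * theta ^+ m.
Proof.
move=> Wr mxy.
have cg : pot W predT (source y) N x @[N --> \oo] --> gr x y :=
  @green_cvg _ _ _ _ _ walk x y.
apply: cvgr_to_le cg _.
apply: nearW => N; rewrite pot_source.
apply: le_trans (tail_le walk m N (x^-1 * y)%g).
case: (leqP m N) => [mN|Nm].
  rewrite (@big_cat_nat _ _ _ m)//= [X in X + _]big_nat big1 ?add0r// => i /andP[_ im].
  by apply: cpow_far Wr _; apply: leq_ltn_trans mxy; rewrite leq_mul2r (ltnW im) orbT.
rewrite (big_geq (ltnW Nm)) big_nat big1// => i /andP[_ iN].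
apply: cpow_far Wr _; apply: leq_ltn_trans mxy.
by rewrite leq_mul2r (ltnW (ltn_trans iN Nm)) orbT.
Qed.

Lemma step_bound : exists r, forall a, a \in W -> (word_norm S a.1 <= r)%N.
Proof.
elim: W => [|a w [r IH]]; first by exists 0%N.
exists (maxn (word_norm S a.1) r) => b; rewrite inE => /predU1P[->|/IH h].
  exact: leq_maxl.
by rewrite (leq_trans h)// leq_maxr.
Qed.

End Harnack.

Lemma sum_triangle_le {R : realDomainType} (K : nat -> nat -> R) N :
  (forall s k, 0 <= K s k) ->
  \sum_(n < N) \sum_(s < n.+1) K s (n - s)%N <= \sum_(s < N) \sum_(k < N) K s k.
Proof.
move=> K0; have -> : \sum_(n < N) \sum_(s < n.+1) K s (n - s)%N =
    \sum_(s < N) \sum_(k < N - s) K s k.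
  elim: N => [|N IH]; first by rewrite !big_ord0.
  rewrite big_ord_recr [RHS]big_ord_recr /= {}IH.
  rewrite subSn// subnn big_ord1 big_ord_recr /= subnn addrA; congr (_ + _).
  rewrite -big_split; apply: eq_bigr => s _ /=.
  by rewrite subSn ?(ltnW (ltn_ord s))// big_ord_recr.
apply: ler_sum => s _; rewrite -!(big_mkord predT (K s)).
by rewrite [leRHS](@big_cat_nat _ _ _ (N - s))//= ?leq_subr// lerDl sumr_ge0.
Qed.

(** * Sums over weighted paths *)

Section Paths.
Context {R : realType} {G : groupType} (W : seq (G * R)).
Hypothesis Wp : weighted_prob W.
Implicit Types (w : seq (G * R)) (B : pred G).

Definition endp (x : G) w : G := foldl (fun g a => (g * a.1)%g) x w.

Definition wt w : R := \prod_(a <- w) a.2.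

Fixpoint words n : seq (seq (G * R)) :=
  if n is n'.+1 then [seq a :: w | a <- W, w <- words n'] else [:: [::]].

Fixpoint avoid B x w : bool :=
  ~~ B x && (if w is a :: w' then avoid B (x * a.1)%g w' else true).

Lemma avoidP B x w : reflect (forall i, (i <= size w)%N -> ~~ B (endp x (take i w)))
  (avoid B x w).
Proof.
elim: w x => [|a w IH] x /=.
  rewrite andbT; apply: (iffP idP) => [Bx [|i]//|/(_ 0%N isT)//].
apply: (iffP andP) => [[Bx /IH aw] [|i] iw //|aw]; first exact: aw.
by split; [exact: (aw 0%N) | apply/IH => i iw; exact: (aw i.+1)].
Qed.

Lemma words_size n w : w \in words n -> size w = n.
Proof.
by elim: n w => [|n IH] w /=; [rewrite inE => /eqP -> | case/allpairsP => -[a v] /= [_ /IH <- ->]].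
Qed.

Lemma words_steps n w a : w \in words n -> a \in w -> a \in W.
Proof.
elim: n w => [|n IH] w /=; first by rewrite inE => /eqP ->.
case/allpairsP => -[b v] /= [bW vn ->]; rewrite inE => /predU1P[->//|].
exact: IH.
Qed.

Lemma wt_ge0 n w : w \in words n -> 0 <= wt w.
Proof.
move=> wn; rewrite /wt big_seq; apply: prodr_ge0 => a /(words_steps wn) aW.
by case: Wp => + _; apply.
Qed.

Lemma big_words_cat m n (F : seq (G * R) -> R) :
  \sum_(w <- words (m + n)) F w = \sum_(u <- words m) \sum_(v <- words n) F (u ++ v).
Proof.
elim: m F => [|m IH] F; first by rewrite big_seq1.
rewrite addSn /= !big_allpairs_dep; apply: eq_bigr => a _.
exact: IH (fun w => F (a :: w)).
Qed.

Lemma wt_cat u v : wt (u ++ v) = wt u * wt v.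
Proof. exact: big_cat. Qed.

Lemma endp_cat x u v : endp x (u ++ v) = endp (endp x u) v.
Proof. exact: foldl_cat. Qed.

Definition esum_paths N (F : seq (G * R) -> R) : R :=
  \sum_(n < N) \sum_(w <- words n) wt w * F w.

Lemma esum_paths_le N F H :
  (forall w, (size w < N)%N -> {subset w <= W} -> F w <= H w) ->
  esum_paths N F <= esum_paths N H.
Proof.
move=> FH; apply: ler_sum => n _; rewrite !big_seq; apply: ler_sum => w wn.
rewrite ler_wpM2l ?(wt_ge0 wn)//; apply: FH; first by rewrite (words_size wn).
by move=> a; exact: words_steps wn.
Qed.

Lemma esum_paths_ge0 N F : (forall w, 0 <= F w) -> 0 <= esum_paths N F.
Proof.
move=> F0; apply: sumr_ge0 => n _; rewrite big_seq; apply: sumr_ge0 => w wn.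
by rewrite mulr_ge0 ?(wt_ge0 wn).
Qed.

Lemma esum_paths_sum (I : Type) (r : seq I) N (F : I -> seq (G * R) -> R) :
  esum_paths N (fun w => \sum_(i <- r) F i w) = \sum_(i <- r) esum_paths N (F i).
Proof.
rewrite /esum_paths exchange_big; apply: eq_bigr => n _ /=.
by rewrite exchange_big; apply: eq_bigr => w _; rewrite mulr_sumr.
Qed.

Lemma esum_pathsZ N F c : esum_paths N (fun w => c * F w) = c * esum_paths N F.
Proof.
rewrite /esum_paths mulr_sumr; apply: eq_bigr => n _.
by rewrite mulr_sumr; apply: eq_bigr => w _; rewrite mulrCA.
Qed.

(** A union bound over the cutting time. Pairs of pieces of total length below N form a triangle,
    which is enlarged to the square of pairs with both lengths below N so that the two sums
    decouple. *)
Lemma esum_paths_split N F H : (forall u v, 0 <= H u v) ->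
  (forall w, F w <= \sum_(s < (size w).+1) H (take s w) (drop s w)) ->
  esum_paths N F <= esum_paths N (fun u => esum_paths N (fun v => H u v)).
Proof.
move=> H0 FH; pose K s k := \sum_(u <- words s) \sum_(v <- words k) wt u * wt v * H u v.
have K0 s k : 0 <= K s k.
  rewrite /K big_seq; apply: sumr_ge0 => u us; rewrite big_seq; apply: sumr_ge0 => v vk.
  by rewrite !mulr_ge0 ?(wt_ge0 us) ?(wt_ge0 vk).
apply: (@le_trans _ _ (\sum_(n < N) \sum_(s < n.+1) K s (n - s)%N)).
  apply: ler_sum => n _.
  apply: (@le_trans _ _ (\sum_(w <- words n) \sum_(s < n.+1) wt w * H (take s w) (drop s w))).
    rewrite !big_seq; apply: ler_sum => w wn.
    by rewrite -mulr_sumr ler_wpM2l ?(wt_ge0 wn)// -[n in n.+1](words_size wn).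
  rewrite exchange_big; apply: ler_sum => s _ /=.
  have sn : (s <= n)%N by rewrite -ltnS.
  rewrite -{1}(subnKC sn) big_words_cat /K le_eqVlt; apply/orP; left; apply/eqP.
  rewrite big_seq [RHS]big_seq; apply: eq_bigr => u us; apply: eq_bigr => v _.
  by rewrite wt_cat take_size_cat ?drop_size_cat// (words_size us).
have -> : esum_paths N (fun u => esum_paths N (fun v => H u v)) =
    \sum_(s < N) \sum_(k < N) K s k.
  apply: eq_bigr => s _; rewrite exchange_big; apply: eq_bigr => u _ /=.
  rewrite mulr_sumr; apply: eq_bigr => k _; rewrite mulr_sumr.
  by apply: eq_bigr => v _; rewrite mulrA.
exact: sum_triangle_le.
Qed.

Lemma words_avoid_pot B N x y :
  esum_paths N (fun w => (avoid B x w && (endp x w == y))%:R) =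
  pot W (predC B) (ksource B y) N x.
Proof.
rewrite /esum_paths; elim: N x => [|N IH] x; first by rewrite big_ord0.
rewrite big_ord_recl /= big_seq1 /wt big_nil mul1r /= andbT; congr (_ + _).
transitivity (\sum_(i < N) (~~ B x)%:R * markov W (fun x' => \sum_(w <- words i)
    wt w * (avoid B x' w && (endp x' w == y))%:R) x).
  apply: eq_bigr => i _; rewrite big_allpairs_dep /markov mulr_sumr.
  apply: eq_bigr => a _; rewrite !mulr_sumr; apply: eq_bigr => w _ /=.
  by rewrite big_cons; case: (B x); rewrite /= ?mulr0 ?mul0r ?mul1r ?mulrA.
by rewrite -mulr_sumr -markov_sum; congr (_ * markov W _ _); apply/funext => z; rewrite -IH.
Qed.

End Paths.

(** * Paths containing a slow section *)

Section UnionBound.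
Context {R : realType} {G : groupType} (S : set G) (W : seq (G * R)) (C theta : R).
Hypothesis genS : finite_symmetric_generating S.
Hypothesis walk : decaying_walk W C theta.
Let Wp := walk_prob walk.
Local Notation dist := (word_dist S).
Local Notation gr := (gr W).
Local Notation gb := (green_bound C theta).

Lemma big_words_endp n x y :
  \sum_(w <- words W n) wt w * (endp x w == y)%:R = cpow W n (x^-1 * y)%g.
Proof.
rewrite -markov_pow_cpow; elim: n x => [|n IH] x.
  by rewrite big_seq1 /wt big_nil mul1r.
rewrite big_allpairs_dep [RHS]/= /markov; apply: eq_bigr => a _.
by rewrite -IH mulr_sumr; apply: eq_bigr => w _; rewrite /wt big_cons mulrA.
Qed.

Lemma esum_endp_le N x y : esum_paths W N (fun w => (endp x w == y)%:R) <= gr x y.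
Proof.
apply: le_trans (pot_le_gr walk N x y); rewrite pot_source big_mkord.
by apply: ler_sum => n _; rewrite big_words_endp.
Qed.

Lemma esum_tail_le N L x y :
  esum_paths W N (fun w => (L <= size w)%:R * (endp x w == y)%:R) <= gb * theta ^+ L.
Proof.
apply: le_trans (tail_le walk L N (x^-1 * y)%g).
have -> : \sum_(L <= n < N) cpow W n (x^-1 * y)%g =
    \sum_(n < N) (L <= n)%:R * cpow W n (x^-1 * y)%g.
  case: (leqP L N) => [LN|NL].
    rewrite -(big_mkord predT (fun n => (L <= n)%:R * cpow W n (x^-1 * y)%g)).
    rewrite [RHS](@big_cat_nat _ _ _ L)//= [X in _ = X + _]big_nat.
    rewrite [X in _ = X + _]big1 ?add0r => [|n /andP[_]].
      by apply: eq_big_nat => n /andP[-> _]; rewrite mul1r.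
    by rewrite ltnNge => /negbTE ->; rewrite mul0r.
  rewrite big_geq ?(ltnW NL)// big1// => n _.
  by rewrite leqNgt (ltn_trans (ltn_ord n) NL) mul0r.
apply: ler_sum => n _; rewrite -big_words_endp mulr_sumr !big_seq.
apply: ler_sum => w wn; rewrite (words_size wn) mulrCA.
by rewrite lexx.
Qed.

Lemma geometric_half_tail N D :
  \sum_(m < N) (D <= m)%:R * (2^-1 : R) ^+ m <= 2 * 2^-1 ^+ D.
Proof.
(* The induction needs the exact partial sum; the bound 2 * 2^-D alone does not propagate. *)
have h : \sum_(m < N) (D <= m)%:R * (2^-1 : R) ^+ m <=
    (D <= N)%:R * (2 * 2^-1 ^+ D - 2 * 2^-1 ^+ N).
  elim: N => [|N IH].
    by rewrite big_ord0; case: D => [|D]; rewrite ?mul0r// subrr mulr0.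
  rewrite big_ord_recr /=; apply: (le_trans (lerD IH (lexx _))).
  have e : (2^-1 : R) ^+ N = 2 * 2^-1 ^+ N.+1 by rewrite exprS mulrA divff// mul1r.
  have [DN|ND] := leqP D N.
    rewrite (leqW DN) !mul1r -mulrBr; have := e; set a := _ ^+ N; set b := _ ^+ N.+1.
    by set d := _ ^+ D => ab; lra.
  rewrite !mul0r addr0; have [DN|_] := leqP D N.+1; last by rewrite mul0r.
  have -> : D = N.+1 by apply/eqP; rewrite eqn_leq DN.
  by rewrite subrr mulr0.
apply: (le_trans h); case: (D <= N)%N; rewrite ?mul0r ?mul1r.
  by rewrite lerBlDr lerDl mulr_ge0// exprn_ge0.
by rewrite mulr_ge0// exprn_ge0.
Qed.

Lemma esum_paths_ext N (F H : seq (G * R) -> R) :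
  (forall w, F w = H w) -> esum_paths W N F = esum_paths W N H.
Proof. by move=> FH; congr esum_paths; exact/funext. Qed.

Definition esum3 N (F : seq (G * R) -> seq (G * R) -> seq (G * R) -> R) : R :=
  esum_paths W N (fun u => esum_paths W N (fun v => esum_paths W N (fun t => F u v t))).

Lemma esum3_sum (I : Type) (r : seq I) N F :
  esum3 N (fun u v t => \sum_(i <- r) F i u v t) = \sum_(i <- r) esum3 N (F i).
Proof.
rewrite /esum3 -[RHS]esum_paths_sum; apply: esum_paths_ext => u.
by rewrite -[RHS]esum_paths_sum; apply: esum_paths_ext => v; exact: esum_paths_sum.
Qed.

Lemma esum3_prod N c (f g h : seq (G * R) -> R) :
  esum3 N (fun u v t => c * (f u * (g v * h t))) =
  c * (esum_paths W N f * (esum_paths W N g * esum_paths W N h)).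
Proof.
rewrite /esum3; transitivity (esum_paths W N (fun u =>
  (c * (esum_paths W N g * esum_paths W N h)) * f u)); last by rewrite esum_pathsZ; ring.
apply: esum_paths_ext => u; transitivity (esum_paths W N (fun v =>
  (c * f u * esum_paths W N h) * g v)); last by rewrite esum_pathsZ; ring.
apply: esum_paths_ext => v; transitivity (esum_paths W N (fun t =>
  (c * f u * g v) * h t)); last by rewrite esum_pathsZ; ring.
by apply: esum_paths_ext => t; ring.
Qed.

(** Cut at the ends p, q of the slow section, at distances m1, m2 from z. The pieces contribute at
    most G(x,p), gb * theta^(La (m1 + m2)) and G(q,y) <= c^(m1 + m2) G(p,y), and G(x,p) G(p,y) <= gb
    G(x,y). There are at most |S|^m1 and |S|^m2 choices of p and q, so the sums over m1, m2 >= D are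
    geometric with ratio 1/2: hence the square of gb * (2 * 2^-D). *)
Lemma inefficient_section_bound (c : R) La D B x y z : 1 <= c ->
  (forall u x x', superharmonic W u -> u x' <= c ^+ dist x x' * u x) ->
  (0 < La)%N -> (size (gens S))%:R * (c * theta ^+ La) <= 2^-1 ->
  (forall w : seq (G * R), {subset w <= W} -> avoid B x w -> endp x w = y ->
     exists s l, [/\ (s + l <= size w)%N,
       (D <= dist z (endp x (take s w)))%N,
       (D <= dist z (endp x (take (s + l) w)))%N &
       (La * (dist z (endp x (take s w)) + dist z (endp x (take (s + l) w))) <= l)%N]) ->
  kgr W B x y <= (gb * (2 * 2^-1 ^+ D)) ^+ 2 * gr x y.
Proof.
move=> c1 har La0 small bad; set v := (size (gens S))%:R in small.
have c0 : 0 <= c := le_trans ler01 c1.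
have th0 := ltW (walk_theta0 walk).
apply: (Pot_lub Wp (ksource_ge0 B y) (ksol walk B y)) => N.
rewrite -words_avoid_pot.
pose H2 (u v t : seq (G * R)) : R := let p := endp x u in let q := endp p v in
  [&& (D <= dist z p)%N, (D <= dist z q)%N,
      (La * (dist z p + dist z q) <= size v)%N & endp q t == y]%:R.
have H20 u w t : 0 <= H2 u w t by [].
pose H1 (u v : seq (G * R)) : R := \sum_(l < (size v).+1) H2 u (take l v) (drop l v).
have H10 u w : 0 <= H1 u w by apply: sumr_ge0.
(* [esum_paths_split] quantifies over all words, whereas [bad] speaks only of those with steps in W;
   the indicator carries this information along. *)
pose F (w : seq (G * R)) : R := (all (mem W) w && (avoid B x w && (endp x w == y)))%:R.
apply: (@le_trans _ _ (esum_paths W N F)).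
  apply: esum_paths_le => // w _ wW; rewrite /F.
  by have -> : all (mem W) w by apply/allP => a /wW.
apply: (@le_trans _ _ (esum_paths W N (fun u => esum_paths W N (fun v => H1 u v)))).
  apply: esum_paths_split => // w; rewrite /F.
  case/boolP: (_ && _) => [/and3P[wW aw /eqP ey]|_]; last by apply: sumr_ge0.
  have [s [l [slw Dp Dq Lal]]] := bad w (fun a aw => allP wW a aw) aw ey.
  have sw : (s < (size w).+1)%N by rewrite ltnS (leq_trans (leq_addr l s)).
  have lw : (l < (size (drop s w)).+1)%N by rewrite ltnS size_drop; lia.
  rewrite (bigD1 (Ordinal sw))//= ler_wpDr ?sumr_ge0//.
  rewrite /H1 (bigD1 (Ordinal lw))//= ler_wpDr ?sumr_ge0//.
  have e1 : endp (endp x (take s w)) (take l (drop s w)) = endp x (take (s + l) w).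
    by rewrite takeD endp_cat.
  have e2 : endp (endp (endp x (take s w)) (take l (drop s w))) (drop l (drop s w)) = y.
    by rewrite -!endp_cat catA -takeD drop_drop addnC cat_take_drop.
  rewrite /H2 e2 e1 Dp Dq eqxx andbT /= ler1n.
  by rewrite size_takel ?Lal// size_drop; lia.
apply: (@le_trans _ _ (esum_paths W N (fun u => esum_paths W N (fun v =>
    esum_paths W N (fun t => H2 u v t))))).
  apply: esum_paths_le => // u _ _; exact: esum_paths_split.
(* Once the cut points are fixed as z * u1 and z * u2, the indicator is a product of functions of u,
   v and t, and the triple sum factorises by [esum3_prod]. *)
pose T (m1 m2 : nat) (u1 u2 : G) (u v t : seq (G * R)) : R := (endp x u == (z * u1)%g)%:R *
  (((La * (m1 + m2) <= size v)%N%:R * (endp (z * u1)%g v == (z * u2)%g)%:R) *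
  (endp (z * u2)%g t == y)%:R).
have T0 m1 m2 u1 u2 u w t : 0 <= T m1 m2 u1 u2 u w t by rewrite !mulr_ge0.
apply: (@le_trans _ _ (esum_paths W N (fun u => esum_paths W N (fun v =>
    esum_paths W N (fun t => \sum_(m1 < N) \sum_(m2 < N) \sum_(u1 <- sphere S m1)
      \sum_(u2 <- sphere S m2) ((D <= m1)%:R * (D <= m2)%:R) * T m1 m2 u1 u2 u v t))))).
  apply: esum_paths_le => // u _ _; apply: esum_paths_le => // w wN _.
  apply: esum_paths_le => // t _ _; rewrite /H2 /=.
  set p := endp x u; set q := endp p w.
  have S0 m1 m2 (r1 r2 : seq G) : 0 <= \sum_(u1 <- r1) \sum_(u2 <- r2)
      ((D <= m1)%:R * (D <= m2)%:R) * T m1 m2 u1 u2 u w t.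
    by do 2!apply: sumr_ge0 => ? _; rewrite mulr_ge0.
  case/boolP: [&& _, _, _ & _] => [/and4P[Dp Dq Lal /eqP ey]|_]; last first.
    by do 2!apply: sumr_ge0 => ? _; exact: S0.
  (* The length of the middle piece dominates both distances, so m1 and m2 may range below N. *)
  have pqN : (dist z p + dist z q < N)%N.
    by apply: leq_ltn_trans wN; apply: leq_trans Lal; rewrite leq_pmull.
  have pN : (dist z p < N)%N by apply: leq_ltn_trans pqN; exact: leq_addr.
  have qN : (dist z q < N)%N by apply: leq_ltn_trans pqN; exact: leq_addl.
  rewrite (bigD1 (Ordinal pN))//= ler_wpDr//.
    by apply: sumr_ge0 => ? _; apply: sumr_ge0 => ? _; exact: S0.
  rewrite (bigD1 (Ordinal qN))//= ler_wpDr//; first by apply: sumr_ge0 => ? _; exact: S0.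
  rewrite (big_rem (z^-1 * p)%g)/=; last exact: sphere_norm.
  rewrite ler_wpDr//.
  rewrite (big_rem (z^-1 * q)%g)/=; last exact: sphere_norm.
  rewrite ler_wpDr//; first by apply: sumr_ge0 => ? _; rewrite mulr_ge0.
  by rewrite /T !mulVKg -/p -/q ey !eqxx Dp Dq Lal !mulr1.
rewrite -/(esum3 N (fun u v t => \sum_(m1 < N) \sum_(m2 < N) \sum_(u1 <- sphere S m1)
  \sum_(u2 <- sphere S m2) ((D <= m1)%:R * (D <= m2)%:R) * T m1 m2 u1 u2 u v t)).
pose K : R := gb ^+ 2 * gr x y.
have gb0 := ltW (green_bound_gt0 walk).
have term m1 m2 u1 u2 : u1 \in sphere S m1 -> u2 \in sphere S m2 ->
    esum3 N (fun u v t => ((D <= m1)%:R * (D <= m2)%:R) * T m1 m2 u1 u2 u v t) <=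
    ((D <= m1)%:R * (c * theta ^+ La) ^+ m1) *
    ((D <= m2)%:R * (c * theta ^+ La) ^+ m2) * K.
  move=> um1 um2; rewrite esum3_prod.
  have h1 := esum_endp_le N x (z * u1)%g.
  have h2 := esum_tail_le N (La * (m1 + m2)) (z * u1)%g (z * u2)%g.
  have h3 := esum_endp_le N (z * u2)%g y.
  have h4 : gr (z * u2)%g y <= c ^+ (m1 + m2) * gr (z * u1)%g y.
    apply: (le_trans (har _ (z * u1)%g (z * u2)%g (superharmonic_gr walk y))).
    rewrite ler_wpM2r ?(gr_ge0 walk)// ler_weXn2l//.
    apply: (leq_trans (dist_tri genS z _ _)).
    rewrite (dist_sym genS) !dist_mulr leq_add //; exact: sphereP um1 || exact: sphereP um2.
  have h5 := gr_mul_le walk x (z * u1)%g (superharmonic_gr walk y).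
  have -> : (D <= m1)%:R * (c * theta ^+ La) ^+ m1 *
      ((D <= m2)%:R * (c * theta ^+ La) ^+ m2) * K =
    (D <= m1)%:R * (D <= m2)%:R * ((gb * theta ^+ (La * (m1 + m2))) *
      (c ^+ (m1 + m2) * (gb * gr x y))).
    rewrite exprM /K; move: (theta ^+ La) => th; rewrite !(exprMn _ c) !exprD.
    move: (c ^+ m1) (c ^+ m2) (th ^+ m1) (th ^+ m2) => a1 a2 b1 b2; ring.
  rewrite ler_wpM2l ?mulr_ge0//.
  have e0 (f : seq (G * R) -> R) : (forall w, 0 <= f w) -> 0 <= esum_paths W N f.
    exact: esum_paths_ge0.
  apply: (@le_trans _ _ (gr x (z * u1)%g *
      ((gb * theta ^+ (La * (m1 + m2))) * (c ^+ (m1 + m2) * gr (z * u1)%g y)))).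
    apply: ler_pM => //; first exact: e0.
      by rewrite mulr_ge0// e0// => w; rewrite mulr_ge0.
    apply: ler_pM => //; [by apply: e0 => w; rewrite mulr_ge0|exact: e0|].
    exact: le_trans h4.
  rewrite mulrCA; apply: ler_wpM2l; first by rewrite mulr_ge0 ?exprn_ge0.
  by rewrite mulrCA; apply: ler_wpM2l; rewrite ?exprn_ge0.
set q := c * theta ^+ La in term small.
have q0 : 0 <= q by rewrite mulr_ge0// exprn_ge0.
have K0 : 0 <= K by rewrite mulr_ge0 ?exprn_ge0// (gr_ge0 walk).
rewrite esum3_sum.
apply: (@le_trans _ _ (\sum_(m1 < N) \sum_(m2 < N)
   ((D <= m1)%:R * 2^-1 ^+ m1) * ((D <= m2)%:R * 2^-1 ^+ m2) * K)).
  apply: ler_sum => m1 _; rewrite esum3_sum; apply: ler_sum => m2 _.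
  rewrite esum3_sum.
  apply: (@le_trans _ _ (\sum_(u1 <- sphere S m1) \sum_(u2 <- sphere S m2)
     ((D <= m1)%:R * q ^+ m1) * ((D <= m2)%:R * q ^+ m2) * K)).
    rewrite !big_seq; apply: ler_sum => u1 um1; rewrite esum3_sum.
    by rewrite !big_seq; apply: ler_sum => u2 um2; exact: term.
  rewrite !big_const_seq !count_predT !iter_addr_0 !size_sphere.
  rewrite -(mulr_natr _ (size (gens S) ^ m1)) -(mulr_natr _ (size (gens S) ^ m2)).
  rewrite !natrX -/v.
  have pw m : q ^+ m * v ^+ m <= 2^-1 ^+ m.
    have qv : q * v <= 2^-1 by rewrite mulrC.
    have qv0 : 0 <= q * v by rewrite mulr_ge0 ?ler0n.
    have h0 : 0 <= 2^-1 :> R by rewrite invr_ge0.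
    by rewrite -exprMn lerXn2r ?nnegrE.
  have -> : (D <= m1)%:R * q ^+ m1 * ((D <= m2)%:R * q ^+ m2) * K * v ^+ m2 * v ^+ m1 =
    ((D <= m1)%:R * (q ^+ m1 * v ^+ m1)) * ((D <= m2)%:R * (q ^+ m2 * v ^+ m2)) * K by ring.
  rewrite ler_wpM2r//; apply: ler_pM; rewrite ?mulr_ge0 ?exprn_ge0 ?ler0n//.
    by rewrite ler_wpM2l.
  by rewrite ler_wpM2l.
under eq_bigr => m1 _ do rewrite -mulr_suml -mulr_sumr.
rewrite -!mulr_suml /K.
set s := \sum_(_ < N) _.
have s1 : s <= 2 * 2^-1 ^+ D by exact: geometric_half_tail.
have s0 : 0 <= s by apply: sumr_ge0 => m _; rewrite mulr_ge0 ?exprn_ge0 ?invr_ge0.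
have -> : s * s * (gb ^+ 2 * gr x y) = (gb * s) ^+ 2 * gr x y by ring.
apply: ler_wpM2r; first exact: (gr_ge0 walk).
have A0 : 0 <= gb * s by rewrite mulr_ge0.
have AB : gb * s <= gb * (2 * 2^-1 ^+ D) by rewrite ler_wpM2l.
by rewrite lerXn2r ?nnegrE// (le_trans A0).
Qed.

End UnionBound.

(** * A bottleneck property of Morse rays *)

Section Chains.
Context {G : Type} (A : G -> G -> Prop).

Fixpoint reach k g h : Prop :=
  if k is k'.+1 then exists2 g', A g g' & reach k' g' h else g = h.

Lemma reach_cat i k g h l : reach i g h -> reach k h l -> reach (i + k) g l.
Proof.
elim: i g => [|i IH] g /=; first by move=> ->.
by move=> [g' gg' /IH r] /r hl; exists g'.
Qed.

Lemma reach_fun k g h : reach k g h -> exists f : nat -> G,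
  [/\ f 0%N = g, f k = h & forall i, (i < k)%N -> A (f i) (f i.+1)].
Proof.
elim: k g => [|k IH] g /=; first by move=> ->; exists (fun=> h).
move=> [g' gg' /IH[f [f0 fk fA]]].
exists (fun i => if i is i'.+1 then f i' else g); split=> // -[|i] //.
  by rewrite f0.
exact: fA.
Qed.

Lemma fun_reach (f : nat -> G) i k :
  (forall j, (i <= j < i + k)%N -> A (f j) (f j.+1)) -> reach k (f i) (f (i + k)%N).
Proof.
elim: k i => [|k IH] i fA /=; first by rewrite addn0.
exists (f i.+1); first by apply: fA; lia.
by rewrite -addSnnS; apply: IH => j ij; apply: fA; lia.
Qed.

Lemma reach_min g h k : reach k g h -> exists f M,
  [/\ f 0%N = g, f M = h, (forall i, (i < M)%N -> A (f i) (f i.+1)) &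
    forall i j l, (i <= j <= M)%N -> reach l (f i) (f j) -> (j - i <= l)%N].
Proof.
move=> r; have ne : exists n, `[< reach n g h >] by exists k; exact/asboolP.
have [M /asboolP rM Mmin] := ex_minnP ne.
have [f [f0 fM fA]] := reach_fun rM; exists f, M; split=> // i j l /andP[ij jM] rl.
have r1 : reach i (f 0%N) (f i).
  by have := @fun_reach f 0%N i; apply => p /andP[_ pi]; apply: fA; lia.
have r2 : reach (M - j) (f j) (f M).
  have := @fun_reach f j (M - j)%N; rewrite subnKC//; apply => p /andP[_ pi].
  by apply: fA; lia.
have /asboolP/Mmin : reach (i + l + (M - j)) g h.
  by rewrite -f0 -fM; apply: reach_cat r2; exact: reach_cat r1 rl.
lia.
Qed.

End Chains.

Lemma last_before (P : nat -> Prop) i0 : P 0%N -> ~ P i0 ->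
  exists i1, [/\ (i1 < i0)%N, P i1 & forall i, (i1 < i <= i0)%N -> ~ P i].
Proof.
elim: i0 => [//|i IH] P0 Pi.
have [Pi'|/(IH P0)[i1 [i1i Pi1 H]]] := pselect (P i).
  by exists i; split=> // k ik; have -> : k = i.+1 by lia.
exists i1; split=> //; first exact: leqW.
move=> k /andP[ik ki]; have [->//|kn] := eqVneq k i.+1; apply: H; lia.
Qed.

Lemma first_after (P : nat -> Prop) i0 M : (i0 <= M)%N -> P M -> ~ P i0 ->
  exists i2, [/\ (i0 < i2 <= M)%N, P i2 & forall i, (i0 <= i < i2)%N -> ~ P i].
Proof.
move=> i0M PM Pi0.
have [] := @last_before (fun i => P (M - i)%N) (M - i0)%N; rewrite ?subn0 ?subKn//.
move=> i1 [i1M Pi1 H]; exists (M - i1)%N; split=> //; first by lia.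
move=> i /andP[i0i iM]; have := H (M - i)%N; rewrite subKn; last by lia.
by apply; lia.
Qed.

Section Bottleneck.
Context {R : realType} {G : groupType} (S : set G).
Hypothesis genS : finite_symmetric_generating S.
Local Notation dist := (word_dist S).

Lemma geodesic_dist (gamma : nat -> G) m n : geodesic_ray S gamma ->
  dist (gamma m) (gamma n) = ((n - m) + (m - n))%N.
Proof.
move=> [_ geo]; case: (leqP m n) => [mn|/ltnW nm].
  by rewrite geo// (eqP mn) addn0.
by rewrite dist_sym// geo// (eqP nm).
Qed.

(** The double inequality says |s - t| <= La without truncated subtraction. If the steps of om have
    length at most r, a shortcut spans word distance at most r * La. *)
Definition shortcut_adj (om : nat -> G) (N La : nat) (g h : G) : Prop :=
  (exists2 s, S s & h = (g * s)%g) \/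
  (exists s t, [/\ (s <= N)%N, (t <= N)%N, (s <= t + La <= s + La + La)%N, g = om s & h = om t]).

Lemma walk_dist r N (om : nat -> G) s t : (forall i, (i < N)%N -> (dist (om i) (om i.+1) <= r)%N) ->
  (s <= t <= N)%N -> (dist (om s) (om t) <= r * (t - s))%N.
Proof.
move=> om_r /andP[st tN]; rewrite -(subnKC st) in tN *; rewrite addKn.
elim: (t - s)%N tN => [|k IH] tN; first by rewrite addn0 dist_refl.
rewrite addnS mulnSr; apply: (leq_trans (dist_tri genS (om (s + k)%N) _ _)).
by apply: leq_add; [apply: IH; lia | apply: om_r; lia].
Qed.

Lemma shortcut_adj_dist om N La r g h : (forall i, (i < N)%N -> (dist (om i) (om i.+1) <= r)%N) ->
  shortcut_adj om N La g h -> (dist g h <= maxn 1 (r * La))%N.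
Proof.
move=> om_r [[s Ss ->]|[s [t [sN tN stL -> ->]]]].
  by rewrite dist_mulr leq_max word_norm_gen.
rewrite leq_max; apply/orP; right; case: (leqP s t) => st.
  apply: (leq_trans (walk_dist om_r _)); first by rewrite st.
  by rewrite leq_mul2l; apply/orP; right; lia.
rewrite dist_sym//; apply: (leq_trans (walk_dist om_r _)); first by rewrite (ltnW st).
by rewrite leq_mul2l; apply/orP; right; lia.
Qed.

Lemma reach_cayley om N La g h : reach (shortcut_adj om N La) (dist g h) g h.
Proof.
rewrite /word_dist; have [w [wS wg <-]] := word_normP genS (g^-1 * h)%g.
have -> : h = (g * \prod_(s <- w) s)%g by rewrite wg mulVKg.
elim: w g {wg} wS => [|s w IH] g wS; first by rewrite big_nil mulg1.
exists (g * s)%g.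
  by left; exists s => //; apply: wS; rewrite /= inE eqxx.
by rewrite big_cons mulgA; apply: IH => t tw; apply: wS; rewrite /= inE tw orbT.
Qed.

Lemma reach_walk om N La m s t : (s <= N)%N -> (t <= N)%N ->
  (s - t + (t - s) <= m * La)%N -> reach (shortcut_adj om N La) m (om s) (om t).
Proof.
elim: m s => [|m IH] s sN tN; rewrite ?mul0n ?mulSn => stm.
  by have -> : s = t by lia.
case: (leqP s t) => st.
  exists (om (minn (s + La) t)); last by apply: IH; lia.
  by right; exists s, (minn (s + La) t); split=> //; lia.
exists (om (maxn (s - La) t)); last by apply: IH; lia.
by right; exists s, (maxn (s - La) t); split=> //; lia.
Qed.

(** Quasi-geodesics are parametrised by real times; rounding down changes a time difference by less
    than 1, which the additive constant L absorbs. *)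
Lemma quasi_geodesic_floor (f : nat -> G) (L M : nat) : (0 < L)%N ->
  (forall i j, (i <= j <= M)%N -> (j - i <= dist (f i) (f j) <= L * (j - i))%N) ->
  quasi_geodesic S (L%:R : R) 0 M%:R (fun t => f (Num.truncn t)).
Proof.
move=> L0 fL.
have L1 : 1 <= L%:R :> R by rewrite ler1n.
have LV : L%:R^-1 <= 1 :> R by rewrite invf_le1// ltr0n.
have main (s t : R) : s \in `[0, M%:R] -> t \in `[0, M%:R] -> s <= t ->
    L%:R^-1 * `|s - t| - L%:R <= (dist (f (Num.truncn s)) (f (Num.truncn t)))%:R <=
    L%:R * `|s - t| + L%:R.
  rewrite !in_itv /= => /andP[s0 sM] /andP[t0 tM] st.
  have /andP[a1 a2] := truncn_itv s0; have /andP[b1 b2] := truncn_itv t0.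
  have ab : (Num.truncn s <= Num.truncn t)%N by exact: le_truncn.
  have bM : (Num.truncn t <= M)%N by rewrite -(ler_nat R) (le_trans b1).
  have /andP[d1 d2] : (Num.truncn t - Num.truncn s <= dist (f (Num.truncn s)) (f (Num.truncn t))
      <= L * (Num.truncn t - Num.truncn s))%N by apply: fL; rewrite ab.
  rewrite -(ler_nat R) in d1; rewrite -(ler_nat R) natrM in d2.
  rewrite distrC ger0_norm ?subr_ge0//.
  move: a2 b2 d1 d2; rewrite natrB// -!natr1.
  set a := (Num.truncn s)%:R in a1 *; set b := (Num.truncn t)%:R in b1 *.
  move: (dist _ _)%:R => d; move=> a2 b2 d1 d2.
  have ts : 0 <= t - s by lra.
  have h1 : L%:R^-1 * (t - s) <= t - s by rewrite ler_piMl.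
  have h2 : L%:R * (b - a) <= L%:R * (t - s) + L%:R :> R.
    have -> : L%:R * (t - s) + L%:R = L%:R * ((t - s) + 1) :> R by ring.
    by rewrite ler_wpM2l//; lra.
  by apply/andP; split; lra.
move=> s t sI tI; have [st|/ltW ts] := leP s t; first exact: main.
by rewrite distrC dist_sym//; exact: main.
Qed.

Lemma Morse_bottleneck (kappa : R -> {nonneg R}) (r La : nat) : (0 < La)%N ->
  exists k : nat, forall gamma, kappa_Morse_rays S kappa gamma ->
  forall j n, (j <= n)%N -> forall (om : nat -> G) N, om 0%N = 1%g -> om N = gamma n ->
  (forall i, (i < N)%N -> (dist (om i) (om i.+1) <= r)%N) ->
  (exists2 i, (i <= N)%N & (dist (gamma j) (om i) <= k)%N) \/
  exists s t, (s <= t <= N)%N /\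
    (La * (dist (gamma j) (om s) + dist (gamma j) (om t)) <= (t - s) + La * (2 * k + 1))%N.
Proof.
move=> La0; set L := maxn 1 (r * La).
have L0 : (0 < L)%N by rewrite leq_max.
have [K kK] : exists K : nat, (kappa L%:R)%:num <= K%:R.
  by exists (Num.truncn (kappa L%:R)%:num).+1; apply/ltW/truncnS_gt.
(* Points of the ray K-close to consecutive points of f are at most 2 * K + L apart. When they
   straddle z, the point of f is within K more of z. *)
exists (3 * K + L)%N => gamma [gam Mor] j n jn om N om0 omN om_r.
set z := gamma j; set A := shortcut_adj om N La.
have rN : reach A N (om 0%N) (om N).
  apply: reach_walk; rewrite ?leqnn//; nia.
have [f [M [f0 fM fA fmin]]] := reach_min rN.
have fL i l : (i <= l <= M)%N -> (l - i <= dist (f i) (f l) <= L * (l - i))%N.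
  move=> ilM; apply/andP; split; first exact: fmin ilM (reach_cayley _ _ _ _ _).
  apply: (@walk_dist L M f) ilM => p pM.
  by apply: shortcut_adj_dist om_r _; exact: fA.
have near i : exists m, (i <= M)%N -> (dist (f i) (gamma m) <= K)%N.
  have [iM|] := boolP (i <= M)%N; last by exists 0%N.
  have L1 : 1 <= L%:R :> R by rewrite ler1n.
  have M0 : 0 <= M%:R :> R by rewrite ler0n.
  have Mq := Mor _ L1 _ _ _ M0 (quasi_geodesic_floor L0 fL).
  have [|||_ [m _ <-] vK] := Mq _ _ i%:R.
  - by rewrite truncn0 f0 om0; exists 0%N => //; case: gam.
  - by rewrite natrK fM omN; exists n.
  - by rewrite in_itv /= ler0n ler_nat.
  exists m => _; rewrite natrK in vK.
  by rewrite -(ler_nat R) (le_trans vK).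
have [m_ mK] := choice near.
have gd := geodesic_dist _ _ gam.
have [i0 i0M zi0] : exists2 i0, (i0 <= M)%N & (dist z (f i0) <= 3 * K + L)%N.
  have tri := dist_tri genS; have sym := dist_sym genS.
  (* A discrete intermediate value argument: the points of the ray shadowing f start near 1 and end
     near [gamma n], so their indices must pass j. *)
  have cross i : (i <= M)%N -> (m_ i < j)%N \/
      exists2 i0, (i0 <= M)%N & (dist z (f i0) <= 3 * K + L)%N.
    elim: i => [|i IH] iM; case: (ltnP (m_ _) j) => mj; [by left|right|by left|].
      exists 0%N => //; have := mK 0%N isT.
      have g0 : gamma 0%N = 1%g by case: gam.
      rewrite f0 om0 -g0 /z !gd; lia.
    case: (IH (ltnW iM)) => [mi|]; last by right.
    right; exists i.+1 => //.
    have h1 := mK _ iM; have h2 := mK _ (ltnW iM).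
    have /andP[_ h3] := fL i i.+1 (ltac:(lia)); rewrite subSnn muln1 in h3.
    have h4 : (dist (gamma (m_ i)) (gamma (m_ i.+1)) <= K + L + K)%N.
      apply: (leq_trans (tri (f i) _ _)); rewrite -addnA leq_add//; first by rewrite sym.
      by apply: (leq_trans (tri (f i.+1) _ _)); rewrite leq_add.
    apply: (leq_trans (tri (gamma (m_ i.+1)) _ _)); rewrite [dist _ (f _)]sym.
    rewrite gd in h4; rewrite /z gd; lia.
  case: (cross M (leqnn M)) => // mM; exists M => //.
  have := mK M (leqnn M); rewrite fM omN /z !gd; lia.
pose P i := exists2 s, (s <= N)%N & f i = om s.
have [[s sN fs]|nP] := pselect (P i0).
  by left; exists s => //; rewrite -fs.
right; have [i1 [i1i [s sN fs] H1]] : exists i1, [/\ (i1 < i0)%N, P i1 &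
    forall i, (i1 < i <= i0)%N -> ~ P i].
  by apply: last_before => //; exists 0%N.
have [i2 [/andP[i2i i2M] [t tN ft] H2]] : exists i2, [/\ (i0 < i2 <= M)%N, P i2 &
    forall i, (i0 <= i < i2)%N -> ~ P i].
  by apply: first_after => //; exists N.
(* Both ends of a shortcut lie on om, so an edge with an end off om is a Cayley edge. The stretch of
   f from i1 to i2 thus moves at unit speed. *)
have edge i : (i < M)%N -> ~ P i \/ ~ P i.+1 -> (dist (f i) (f i.+1) <= 1)%N.
  move=> /fA[[u uS ->] _|[u [v [uN vN _ fu fv]]] [[]|[]]].
  - by rewrite dist_mulr word_norm_gen.
  - by exists u.
  - by exists v.
have d1 : (dist (f i1) (f i0) <= i0 - i1)%N.
  have gen k : (k <= i0 - i1)%N -> (dist (f i1) (f (i1 + k)%N) <= k)%N.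
    elim: k => [|k IH] ki; first by rewrite addn0 dist_refl.
    apply: (leq_trans (dist_tri genS (f (i1 + k)%N) _ _)).
    rewrite -[X in (_ <= X)%N]addn1; apply: leq_add; first exact: IH (ltnW ki).
    rewrite addnS; apply: edge; first by lia.
    by right; apply: H1; lia.
  by have := gen _ (leqnn _); rewrite subnKC// ltnW.
have d2 : (dist (f i0) (f i2) <= i2 - i0)%N.
  have gen k : (k <= i2 - i0)%N -> (dist (f i0) (f (i0 + k)%N) <= k)%N.
    elim: k => [|k IH] ki; first by rewrite addn0 dist_refl.
    apply: (leq_trans (dist_tri genS (f (i0 + k)%N) _ _)).
    rewrite -[X in (_ <= X)%N]addn1; apply: leq_add; first exact: IH (ltnW ki).
    rewrite addnS; apply: edge; first by lia.
    by left; apply: H2; lia.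
  by have := gen _ (leqnn _); rewrite subnKC// ltnW.
(* Shortcuts along om join its points s and t in |s - t| / La edges, rounded up, and the minimal
   chain f takes no more than that. *)
have d3 : (La * (i2 - i1) <= (s - t + (t - s)) + La)%N.
  have := fmin i1 i2 ((s - t + (t - s)) %/ La).+1 (ltac:(lia)).
  rewrite fs ft =>  /(_ (reach_walk _ sN tN (ltnW (ltn_ceil _ La0)))) h.
  apply: (@leq_trans (La * ((s - t + (t - s)) %/ La).+1)); first by rewrite leq_mul2l h orbT.
  by rewrite mulnS addnC leq_add2r mulnC leq_trunc_div.
have e1 : (dist z (om s) <= 3 * K + L + (i0 - i1))%N.
  rewrite -fs; apply: (leq_trans (dist_tri genS (f i0) _ _)).
  by rewrite leq_add// dist_sym.
have e2 : (dist z (om t) <= 3 * K + L + (i2 - i0))%N.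
  by rewrite -ft; apply: (leq_trans (dist_tri genS (f i0) _ _)); rewrite leq_add.
have e3 : (La * (dist z (om s) + dist z (om t)) <=
    (s - t + (t - s)) + La * (2 * (3 * K + L) + 1))%N.
  apply: (@leq_trans (La * (2 * (3 * K + L) + (i2 - i1)))%N).
    by rewrite leq_mul2l; apply/orP; right; lia.
  by rewrite !mulnDr muln1; lia.
case: (leqP s t) => st.
  by exists s, t; split; lia.
exists t, s; split; first lia.
by rewrite [X in (La * X)%N]addnC; lia.
Qed.

End Bottleneck.

(** * Ancona inequality along Morse rays *)

Lemma pow_small {R : realType} (theta a b : R) : 0 <= theta < 1 -> 0 <= a -> 0 < b ->
  exists n, forall m, (n <= m)%N -> a * theta ^+ m <= b.
Proof.
move=> /andP[th0 th1] a0 b0.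
have c : theta ^+ n @[n --> \oo] --> (0 : R) by apply: cvg_expr; rewrite ger0_norm.
have ba : 0 < b / (a + 1) by rewrite divr_gt0// ltr_wpDl.
have [n _ nP] : \forall n \near \oo, theta ^+ n <= b / (a + 1) by apply: cvgr_le c _ ba.
exists n => m nm.
have := nP m nm; rewrite /= ler_pdivlMr ?ltr_wpDl// => h.
apply: le_trans h; rewrite mulrC ler_wpM2l ?exprn_ge0//.
by rewrite lerDl.
Qed.

Section WeakAncona.
Context {R : realType} {G : groupType} (S : set G) (W : seq (G * R)) (C theta : R).
Hypothesis genS : finite_symmetric_generating S.
Hypothesis walk : decaying_walk W C theta.
Local Notation dist := (word_dist S).
Local Notation gr := (gr W).

(** The bottleneck property concerns paths from 1, so a geodesic from 1 to x is prepended. The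
    condition 20 |x| <= j puts x at distance at least 19 |x| from z: a section cannot lie inside the
    prefix, and one that starts there can be made to start at x at little cost. *)
Lemma inefficient_section (kappa : R -> {nonneg R}) (r La : nat) : (0 < La)%N ->
  (forall a, a \in W -> (word_norm S a.1 <= r)%N) ->
  exists D0, forall D, (D0 <= D)%N ->
  forall gamma, kappa_Morse_rays S kappa gamma ->
  forall x j n, (20 * word_norm S x <= j <= n)%N ->
  forall w : seq (G * R), {subset w <= W} -> avoid (mem (ball S (gamma j) D)) x w ->
    endp x w = gamma n ->
  exists s l, [/\ (s + l <= size w)%N,
    (D <= dist (gamma j) (endp x (take s w)))%N,
    (D <= dist (gamma j) (endp x (take (s + l) w)))%N &
    (La * (dist (gamma j) (endp x (take s w)) +
           dist (gamma j) (endp x (take (s + l) w))) <= l)%N].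
Proof.
move=> La0 Wr; have a0 : (0 < 2 * La)%N by rewrite muln_gt0.
(* Using 2 * La leaves a spare half of the estimate. Since all points of w are farther than 8 * k +
   8 from z, it pays for the additive error and for the part of the section lost in the prefix. *)
have [k kP] := Morse_bottleneck genS kappa (maxn 1 r) a0.
exists (8 * k + 8)%N => D Dk gamma gam x j n /andP[xj jn] w wW aw ew.
have tri := dist_tri genS; have sym := dist_sym genS.
set z := gamma j in aw *.
have [u [uS ux un]] := word_normP genS x.
set l := word_norm S x in un xj.
have g0 : gamma 0%N = 1%g by case: gam => -[].
have far i : (i <= size w)%N -> (D < dist z (endp x (take i w)))%N.
  by move=> iw; have /avoidP/(_ i iw) := aw; rewrite /= mem_ball// -ltnNge.
have far0 : (D < dist z x)%N by have := far 0%N isT; rewrite take0.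
have farx : (19 * l <= dist z x)%N.
  have := tri x 1%g z; rewrite -{1 2}g0 {1}/z geodesic_dist//; last by case: gam.
  rewrite [dist x z]sym subn0 sub0n addn0 => h.
  have e : dist (gamma 0%N) x = l by rewrite g0 /dist /word_dist invg1 mul1g.
  rewrite e in h; lia.
pose om i := if (i <= l)%N then (\prod_(s <- take i u) s)%g else endp x (take (i - l) w).
have omx i : om (l + i)%N = endp x (take i w).
  rewrite /om; case: i => [|i]; last by rewrite -{2}(addn0 l) leq_add2l addKn.
  by rewrite addn0 leqnn -un take_size ux take0.
have om0 : om 0%N = 1%g by rewrite /om take0 big_nil.
pose N := (l + size w)%N.
have omN : om N = gamma n by rewrite omx take_size.
have step1 i : (i < l)%N -> (dist (om i) (om i.+1) <= 1)%N.
  move=> il; rewrite /om (ltnW il) il (take_nth 1%g) ?un// -cats1 big_cat big_seq1 /=.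
  by rewrite dist_mulr word_norm_gen//; apply: uS; rewrite /= mem_nth ?un.
have om_r i : (i < N)%N -> (dist (om i) (om i.+1) <= maxn 1 r)%N.
  move=> iN; case: (ltnP i l) => il; first by rewrite (leq_trans (step1 i il))// leq_maxl.
  rewrite -(subnKC il) -addnS !omx; set p := (i - l)%N.
  have pw : (p < size w)%N by rewrite /p; lia.
  rewrite (take_nth (1%g, 0)) // -cats1 endp_cat /= dist_mulr leq_max Wr ?orbT//.
  by apply: wW; rewrite mem_nth.
have pre i : (i <= l)%N -> (dist z x <= dist z (om i) + l)%N.
  move=> il; apply: (leq_trans (tri (om i) _ _)); rewrite leq_add2l.
  have := @walk_dist _ _ genS 1 l om i l (fun p pl => step1 p pl); rewrite il leqnn => /(_ isT).
  by rewrite -{1}(addn0 l) omx take0 mul1n => /leq_trans; apply; exact: leq_subr.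
case: (kP gamma gam j n jn om N om0 omN om_r) => [[i iN zi]|[s [t [/andP[st tN] ineq]]]].
  case: (leqP i l) => il; first by have := pre i il; rewrite -/z in zi; lia.
  have := far (i - l)%N; rewrite -omx subnKC ?(ltnW il)//; rewrite -/z in zi.
  by move=> /(_ (ltac:(rewrite /N in iN; lia))); lia.
rewrite -/z in ineq; case: (leqP t l) => tl.
  have h1 := pre _ tl; have h2 := pre _ (leq_trans st tl); exfalso; nia.
case: (leqP s l) => sl.
  exists 0%N, (t - l)%N; rewrite add0n take0 /=; rewrite /N in tN.
  have tw : (t - l <= size w)%N by lia.
  split=> //; [exact: ltnW|exact/ltnW/far|].
  have h2 := pre _ sl; rewrite -omx subnKC ?(ltnW tl)//.
  nia.
exists (s - l)%N, (t - s)%N; have -> : (s - l + (t - s) = t - l)%N by lia.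
have tw : (t - l <= size w)%N by rewrite /N in tN; lia.
have sw : (s - l <= size w)%N by lia.
split=> //; [exact/ltnW/far|exact/ltnW/far|].
have f1 := far _ sw; have f2 := far _ tw; move: f1 f2.
rewrite -!omx !subnKC ?(ltnW tl) ?(ltnW sl)//.
nia.
Qed.

Lemma weak_ancona (kappa : R -> {nonneg R}) (eps : R) : 0 < eps ->
  exists D, forall gamma, kappa_Morse_rays S kappa gamma ->
  forall x j n, (20 * word_norm S x <= j <= n)%N ->
  kgr W (mem (ball S (gamma j) D)) x (gamma n) <= eps * gr x (gamma n).
Proof.
move=> eps0; have [c c1 [har _]] := harnack genS walk.
have [r Wr] := step_bound S W.
have th01 : 0 <= theta < 1 by rewrite (walk_theta1 walk) ltW ?(walk_theta0 walk).
have c0 : 0 <= c := le_trans ler01 c1.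
have vc0 : 0 <= (size (gens S))%:R * c by rewrite mulr_ge0.
have h20 : 0 < 2^-1 :> R by rewrite invr_gt0.
have [La0 LaP] := pow_small th01 vc0 h20.
have gb0 := ltW (green_bound_gt0 walk).
have h21 : 0 <= (2^-1 : R) < 1 by rewrite ltW//= invf_lt1// ltr1n.
have gb2 : 0 <= green_bound C theta * 2 by rewrite mulr_ge0.
(* The bound to come is a square q^2, and q <= 1 together with q <= eps gives q^2 <= eps. *)
have m0 : 0 < Num.min 1 eps by rewrite lt_min ltr01.
have [D1 D1P] := pow_small h21 gb2 m0.
have [D0 D0P] := inefficient_section kappa (ltn0Sn La0) Wr.
exists (maxn D0 D1) => gamma gam x j n xjn.
apply: (@le_trans _ _ ((green_bound C theta * (2 * 2^-1 ^+ (maxn D0 D1))) ^+ 2 * gr x (gamma n))).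
  apply: (inefficient_section_bound genS walk c1 har (ltn0Sn La0)).
    by rewrite mulrA; apply: LaP; exact: leqnSn.
  exact: (D0P _ (leq_maxl D0 D1) _ gam _ _ _ xjn).
rewrite ler_wpM2r ?(gr_ge0 walk)// mulrA.
have := D1P _ (leq_maxr D0 D1); set q := _ * _ => qm.
have q0 : 0 <= q by rewrite mulr_ge0 ?exprn_ge0 ?invr_ge0.
have [q1 qe] : q <= 1 /\ q <= eps by move: qm; rewrite le_min => /andP.
by rewrite expr2; apply: le_trans qe; rewrite ler_piMl.
Qed.

End WeakAncona.

(** * Kernels at the end of a Morse ray *)

Section Boundary.
Context {R : realType} {G : groupType} (S : set G) (W : seq (G * R)) (C theta : R).
Hypothesis genS : finite_symmetric_generating S.
Hypothesis walk : decaying_walk W C theta.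
Local Notation dist := (word_dist S).
Local Notation gr := (gr W).
Local Notation gb := (green_bound C theta).
Local Notation ball := (ball S).
Let Wp := walk_prob walk.
Implicit Types (gamma : nat -> G) (K u : G -> R).

Definition mkernel (y x : G) : R := gr x y / gr 1%g y.

(** The converse inequality, with no error term, is optional stopping ([hit_superharmonic]) when K
    is superharmonic. D is chosen before x and j, and the condition passes to pointwise limits since
    the sum is finite. *)
Definition tracks gamma K := forall eps : R, 0 < eps -> exists D, forall x j,
  (20 * word_norm S x <= j)%N ->
  K x <= \sum_(w <- ball (gamma j) D) hit W pred0 (ball (gamma j) D) x w * K w + eps * K x.

Definition harmonic K := (forall x, 0 <= K x) /\ forall x, markov W K x = K x.

Lemma harmonic_superharmonic K : harmonic K -> superharmonic W K.
Proof. by move=> [K0 KP]; split=> // x; rewrite KP. Qed.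

Lemma hit_ball_le D : exists2 B : R, 0 <= B & forall u x z, superharmonic W u ->
  \sum_(w <- ball z D) hit W pred0 (ball z D) x w * u w <= B * (gr x z * u z).
Proof.
have [c c1 [har1 har2]] := harnack genS walk; have c0 : 0 <= c := le_trans ler01 c1.
have [n nP] := size_ball_le S D.
exists (n%:R * (c ^+ D * c ^+ D)); first by rewrite !mulr_ge0 ?exprn_ge0.
move=> u x z us; have [u0 _] := us; set b := ball z D.
apply: (@le_trans _ _ (\sum_(w <- b) (c ^+ D * c ^+ D) * (gr x z * u z))).
  rewrite !big_seq; apply: ler_sum => w; rewrite mem_ball// => wD.
  have cD : c ^+ dist z w <= c ^+ D by exact: ler_weXn2l.
  have h1 : hit W pred0 b x w <= c ^+ D * gr x z.
    apply: (le_trans (hit_le walk _ _ _ _)); apply: (le_trans (har2 x w z)).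
    by rewrite dist_sym// ler_wpM2r ?(gr_ge0 walk).
  have h2 : u w <= c ^+ D * u z.
    by apply: (le_trans (har1 u z w us)); rewrite ler_wpM2r.
  rewrite mulrACA; apply: ler_pM => //; exact: (hit_ge0 walk).
rewrite big_const_seq count_predT iter_addr_0 -(mulr_natl _ (size b)) -[leRHS]mulrA.
apply: ler_wpM2r; last by rewrite ler_nat; exact: nP.
by rewrite !mulr_ge0 ?exprn_ge0 ?(gr_ge0 walk).
Qed.

Lemma tracks_le gamma K : superharmonic W K -> tracks gamma K ->
  exists2 B : R, 0 <= B & forall x j, (20 * word_norm S x <= j)%N ->
    K x <= B * (gr x (gamma j) * K (gamma j)).
Proof.
move=> Ks tr; have [|D DP] := tr 2^-1; first by rewrite invr_gt0.
have [B B0 BP] := hit_ball_le D; exists (2 * B); first by rewrite mulr_ge0.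
move=> x j xj; have h1 := DP x j xj; have h2 := BP K x (gamma j) Ks.
rewrite -mulrA; move: (gr _ _ * _) h1 h2 => g h1 h2.
move: (\sum_(_ <- _) _) h1 h2 => s h1 h2; move: (K x) h1 => k h1; lra.
Qed.

(** Let h = K - a K' and e = (1 - a) / 2. At the point 1 the balayage of K is at least 1 - e and
    that of K' at most 1, so e <= B G(1,z) h(z). Multiply by K'(x) <= const G(x,z) K'(z), valid for
    z far along the ray, and regroup: G(1,z) K'(z) <= gb and G(x,z) h(z) <= gb h(x) bound e K'(x) by
    a multiple of h(x) that is independent of z. *)
Lemma tracks_improve gamma gamma' K K' Cd a :
  geodesic_ray S gamma -> geodesic_ray S gamma' ->
  (forall j, exists j', (dist (gamma j) (gamma' j') <= Cd)%N) ->
  harmonic K -> harmonic K' -> K 1%g = 1 -> K' 1%g = 1 ->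
  tracks gamma K -> tracks gamma' K' ->
  0 <= a < 1 -> (forall x, a * K' x <= K x) ->
  exists2 c, 0 < c & forall x, (a + c) * K' x <= K x.
Proof.
move=> gam gam' near Kh K'h K1 K'1 tr tr' /andP[a0 a1] aK.
have Ks := harmonic_superharmonic Kh; have K's := harmonic_superharmonic K'h.
have [K0 KP] := Kh; have [K'0 K'P] := K'h.
pose h x := K x - a * K' x.
have hs : superharmonic W h.
  split=> x; first by rewrite subr_ge0.
  rewrite /h (_ : (fun x => K x - a * K' x) = (fun x => K x + (- a) * K' x)).
    by rewrite markovD markovZ KP K'P mulNr.
  by apply/funext => y; rewrite mulNr.
have [h0 _] := hs.
pose e := (1 - a) / 2; have e0 : 0 < e by rewrite divr_gt0// subr_gt0.
have [D DP] := tr e e0.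
have [B B0 BP] := hit_ball_le D.
have [B' B'0 B'P] := tracks_le K's tr'.
have [c c1 [har1 har2]] := harnack genS walk; have c0 : 0 <= c := le_trans ler01 c1.
have lower j : e <= B * (gr 1%g (gamma j) * h (gamma j)).
  apply: le_trans (BP h 1%g (gamma j) hs).
  have := DP 1%g j; rewrite word_norm1// muln0 => /(_ (leq0n j)); rewrite K1 mulr1.
  set b := ball _ _; set H := hit _ _ _ _ => h1.
  have h2 : \sum_(w <- b) H w * K' w <= 1.
    rewrite -K'1; apply: (hit_superharmonic walk) => //; first exact: ball_uniq.
    by move=> x; rewrite mul1r K'P.
  have -> : \sum_(w <- b) H w * h w =
      \sum_(w <- b) H w * K w - a * \sum_(w <- b) H w * K' w.
    by rewrite mulr_sumr -sumrB; apply: eq_bigr => w _; rewrite /h; ring.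
  have h3 : a * \sum_(w <- b) H w * K' w <= a by rewrite ler_piMr.
  move: (\sum_(w <- b) H w * K w) h1 (a * _) h3 => s1 h1 s2 h3.
  by rewrite /e in h1 *; lra.
(* The summand 1 makes M positive even if B or B' is 0. *)
pose M := (B' * (c ^+ Cd * c ^+ Cd)) * B * gb * gb + 1.
have gb0 := ltW (green_bound_gt0 walk).
have M1 : 0 <= B' * (c ^+ Cd * c ^+ Cd) * B by rewrite !mulr_ge0 ?exprn_ge0.
have M0 : 0 < M by rewrite ltr_wpDl// (mulr_ge0 (mulr_ge0 M1 gb0) gb0).
exists (e / M); first by rewrite divr_gt0.
move=> x; rewrite mulrDl -lerBrDl -/(h x) mulrAC ler_pdivrMr//.
(* The extra Cd ensures that the companion index j' on gamma' is still at least 20 |x|. *)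
set j := (20 * word_norm S x + Cd)%N; have [j' jj'] := near j.
set z := gamma j in jj'; set z' := gamma' j' in jj'.
have xj' : (20 * word_norm S x <= j')%N.
  have := dist_tri genS z' 1%g z; rewrite [dist z' z]dist_sym//.
  have g0 : gamma 0%N = 1%g by case: gam.
  have g0' : gamma' 0%N = 1%g by case: gam'.
  rewrite -{1}g0 -g0' /z /z' !geodesic_dist// !subn0 !sub0n !addn0 -/z -/z'.
  have jE : j = (20 * word_norm S x + Cd)%N by []; lia.
have h1 := B'P x j' xj'; rewrite -/z' in h1.
have cC : c ^+ dist z z' <= c ^+ Cd by exact: ler_weXn2l.
have h2 : gr x z' <= c ^+ Cd * gr x z.
  by apply: (le_trans (har2 x z' z)); rewrite dist_sym// ler_wpM2r ?(gr_ge0 walk).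
have h3 : K' z' <= c ^+ Cd * K' z.
  by apply: (le_trans (har1 K' z z' K's)); rewrite ler_wpM2r.
have h4 : K' x <= B' * ((c ^+ Cd * gr x z) * (c ^+ Cd * K' z)).
  by apply: (le_trans h1); rewrite ler_wpM2l//; apply: ler_pM; rewrite ?(gr_ge0 walk).
have h5 := lower j; rewrite -/z in h5.
have h6 := gr_mul_le walk 1%g z K's; rewrite K'1 mulr1 in h6.
have h7 := gr_mul_le walk x z hs.
have h8 : e * K' x <= (B * (gr 1%g z * h z)) *
    (B' * ((c ^+ Cd * gr x z) * (c ^+ Cd * K' z))).
  by apply: ler_pM => //; exact: ltW.
apply: (le_trans h8).
have -> : B * (gr 1%g z * h z) * (B' * (c ^+ Cd * gr x z * (c ^+ Cd * K' z))) =
  (B' * (c ^+ Cd * c ^+ Cd) * B) * ((gr 1%g z * K' z) * (gr x z * h z)) by ring.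
apply: (@le_trans _ _ ((B' * (c ^+ Cd * c ^+ Cd) * B) * (gb * (gb * h x)))).
  apply: ler_wpM2l => //.
  by apply: ler_pM => //; apply: mulr_ge0 => //; exact: (gr_ge0 walk).
have -> : B' * (c ^+ Cd * c ^+ Cd) * B * (gb * (gb * h x)) = (M - 1) * h x.
  by rewrite /M; move: gb => g; ring.
by rewrite mulrC; apply: ler_wpM2l => //; rewrite gerBl.
Qed.

Lemma tracks_unique gamma gamma' K K' Cd :
  geodesic_ray S gamma -> geodesic_ray S gamma' ->
  (forall j, exists j', (dist (gamma j) (gamma' j') <= Cd)%N) ->
  harmonic K -> harmonic K' -> K 1%g = 1 -> K' 1%g = 1 ->
  tracks gamma K -> tracks gamma' K' -> K = K'.
Proof.
move=> gam gam' near Kh K'h K1 K'1 tr tr'.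
have Ks := harmonic_superharmonic Kh; have K's := harmonic_superharmonic K'h.
have [K0 KP] := Kh; have [K'0 K'P] := K'h.
pose E : set R := [set a | 0 <= a /\ forall x, a * K' x <= K x].
have E0 : E 0 by split=> // x; rewrite mul0r.
have E1 : ubound E 1 by move=> a [_ /(_ 1%g)]; rewrite K1 K'1 mulr1.
have supE : has_sup E by split; [exists 0 | exists 1].
pose s := sup E.
have s0 : 0 <= s by apply: ub_le_sup => //; exists 1.
have s1 : s <= 1 by apply: ge_sup => //; exists 0.
have sE : E s.
  split=> // x; have [K'x|K'x] := eqVneq (K' x) 0; first by rewrite K'x mulr0.
  have K'x0 : 0 < K' x by rewrite lt_neqAle eq_sym K'x K'0.
  rewrite -ler_pdivlMr//; apply: ge_sup; first by exists 0.
  by move=> a [_ aP]; rewrite ler_pdivlMr.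
have s1e : s = 1.
  apply/eqP; rewrite eq_le s1 leNgt; apply/negP => slt.
  have [|c c0 cP] := tracks_improve gam gam' near Kh K'h K1 K'1 tr tr' _ sE.2.
    by rewrite s0.
  have : s + c <= s.
    by apply: ub_le_sup; [exists 1|split=> //; rewrite addr_ge0// ltW].
  by rewrite gerDl leNgt c0.
have KK' x : K' x <= K x by have := sE.2 x; rewrite s1e mul1r.
pose h x := K x - K' x.
have hs : superharmonic W h.
  split=> x; first by rewrite subr_ge0.
  rewrite /h (_ : (fun x => K x - K' x) = (fun x => K x + (- 1) * K' x)).
    by rewrite markovD markovZ KP K'P mulN1r.
  by apply/funext => y; rewrite mulN1r.
(* The difference is nonnegative, superharmonic and zero at 1, so Harnack forces it to vanish. *)
have [c _ [har _]] := harnack genS walk.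
apply/funext => x; apply/eqP; rewrite -subr_eq0 eq_le subr_ge0 KK' andbT.
apply: (le_trans (har h 1%g x hs)).
by rewrite /h K1 K'1 subrr mulr0.
Qed.

Lemma mkernel_bounds : exists2 c : R, 1 <= c &
  forall x y, 0 <= mkernel y x <= c ^+ word_norm S x.
Proof.
have [c c1 [har _]] := harnack genS walk; exists c => // x y.
have g0 := gr_gt0 walk 1%g y; rewrite /mkernel divr_ge0 ?(gr_ge0 walk)//=.
rewrite ler_pdivrMr//; have := har _ 1%g x (superharmonic_gr walk y).
by rewrite /word_dist invg1 mul1g.
Qed.

(** The rays may vary with i while agreeing with gamma ever longer: a constant sequence serves
    convergence along one ray, a varying one continuity on a stratum. *)
Lemma limit_tracks (kappa : R -> {nonneg R}) gamma (gam_ : nat -> nat -> G) (n_ : nat -> nat)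
    (U : set_system nat) K : ProperFilter U -> \oo `<=` U ->
  (forall i, kappa_Morse_rays S kappa (gam_ i)) ->
  (forall i m, (m <= i)%N -> gam_ i m = gamma m) -> (forall i, (i <= n_ i)%N) ->
  (forall x, mkernel (gam_ i (n_ i)) x @[i --> U] --> K x) ->
  [/\ harmonic K, K 1%g = 1 & tracks gamma K].
Proof.
move=> UP Uoo gamP agree ni Kc.
have UF : Filter U by exact: _.
have g10 y := gr_gt0 walk 1%g y.
have Unear (N : nat) : \forall i \near U, (N <= i)%N.
  by apply: Uoo; exists N.
have [c c1 mb] := mkernel_bounds.
have K0 x : 0 <= K x.
  by apply: cvgr_to_ge (@Kc x) _; apply: nearW => i; have /andP[] := mb x (gam_ i (n_ i)).
split.
- split=> // x; apply/esym.
  have c2 : markov W (mkernel (gam_ i (n_ i))) x @[i --> U] --> markov W K x.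
    by apply: cvg_markov => y; exact: Kc.
  have c3 : markov W (mkernel (gam_ i (n_ i))) x @[i --> U] --> K x.
    apply: cvg_trans (@Kc x); apply: near_eq_cvg.
    apply: filterS (Unear (word_norm S x).+1) => i xi.
    (* The Green function fails to be harmonic only at its pole, whose norm n_ i >= i exceeds that
       of x. *)
    rewrite /mkernel (gr_fix walk x) /source; case: eqP => [xe|_].
      have [[g0 geo] _] := gamP i.
      have : word_norm S x = n_ i.
        have := geo 0%N (n_ i) (leq0n _); rewrite g0 -xe subn0 => <-.
        by rewrite /word_dist invg1 mul1g.
      by move: (ni i) xi; lia.
    rewrite add0r mulrC -markovZ; congr markov.
    by apply/funext => y; rewrite mulrC.
  by apply: (cvg_unique _ c3 c2); exact: Rhausdorff.
- have c2 : mkernel (gam_ i (n_ i)) 1%g @[i --> U] --> (1 : R).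
    by under eq_cvg do rewrite /mkernel divff ?gt_eqF//; exact: cvg_cst.
  by apply: (cvg_unique _ (@Kc 1%g) c2); exact: Rhausdorff.
move=> eps eps0; have [D DP] := weak_ancona genS walk kappa eps0.
exists D => x j xj; set b := ball (gamma j) D.
have c2 : \sum_(w <- b) hit W pred0 b x w * mkernel (gam_ i (n_ i)) w +
    eps * mkernel (gam_ i (n_ i)) x @[i --> U] -->
    \sum_(w <- b) hit W pred0 b x w * K w + eps * K x.
  have c3 r : \sum_(w <- r) hit W pred0 b x w * mkernel (gam_ i (n_ i)) w @[i --> U] -->
      \sum_(w <- r) hit W pred0 b x w * K w.
    elim: r => [|w r IH].
      by rewrite big_nil; under eq_cvg do rewrite big_nil; exact: cvg_cst.
    rewrite big_cons; under eq_cvg do rewrite big_cons.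
    by apply: cvgD; [apply: cvgMl_tmp; exact: Kc | exact: IH].
  by apply: cvgD; [exact: c3 | apply: cvgMl_tmp; exact: Kc].
apply: cvg_le (@Kc x) c2 _; apply: filterS (Unear j) => i ji.
have := DP _ (gamP i) x j (n_ i); rewrite xj (leq_trans ji (ni i)) => /(_ isT).
rewrite (agree i j ji) -/b => anc.
have := gr_decomp walk b x (gam_ i (n_ i)) => dec.
rewrite /mkernel; set g := gr 1%g _.
have -> : \sum_(w <- b) hit W pred0 b x w * (gr w (gam_ i (n_ i)) / g) +
    eps * (gr x (gam_ i (n_ i)) / g) =
  (\sum_(w <- b) hit W pred0 b x w * gr w (gam_ i (n_ i)) + eps * gr x (gam_ i (n_ i))) / g.
  by rewrite mulrDl mulr_suml mulrA; congr (_ + _); apply: eq_bigr => w _; rewrite mulrA.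
rewrite ler_wpM2r ?invr_ge0 ?(ltW (g10 _))//.
by apply: (le_trans dec); rewrite lerD2l.
Qed.

Lemma limit_exists (kappa : R -> {nonneg R}) gamma (gam_ : nat -> nat -> G) (n_ : nat -> nat)
    (F : set_system nat) : ProperFilter F -> \oo `<=` F ->
  (forall i, kappa_Morse_rays S kappa (gam_ i)) ->
  (forall i m, (m <= i)%N -> gam_ i m = gamma m) -> (forall i, (i <= n_ i)%N) ->
  exists U K, [/\ ProperFilter U, F `<=` U,
    forall x, mkernel (gam_ i (n_ i)) x @[i --> U] --> K x &
    [/\ harmonic K, K 1%g = 1 & tracks gamma K]].
Proof.
move=> FP Foo gamP agree ni; have [U [UU FU]] := ultraFilterLemma FP.
have [c _ mb] := mkernel_bounds.
have KP x : exists k : R, mkernel (gam_ i (n_ i)) x @[i --> U] --> k.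
  have [k _ kc] := @ultra_bounded_cvg R _ U (fun i => mkernel (gam_ i (n_ i)) x) 0 _ UU
    (fun i => mb x (gam_ i (n_ i))).
  by exists k.
have [K Kc] := choice KP; exists U, K.
have UP : ProperFilter U by exact: _.
have trk := limit_tracks UP (subset_trans Foo FU) gamP agree ni Kc.
by split.
Qed.

Lemma Morse_limit (kappa : R -> {nonneg R}) gamma K (gam_ : nat -> nat -> G) (n_ : nat -> nat) x :
  geodesic_ray S gamma -> harmonic K -> K 1%g = 1 -> tracks gamma K ->
  (forall i, kappa_Morse_rays S kappa (gam_ i)) ->
  (forall i m, (m <= i)%N -> gam_ i m = gamma m) -> (forall i, (i <= n_ i)%N) ->
  mkernel (gam_ i (n_ i)) x @[i --> \oo] --> K x.
Proof.
move=> gam Kh K1 Kt gamP agree ni; apply/cvgrPdist_lt => e e0; apply: contrapT => nnear.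
pose P := [set i | ~ `|K x - mkernel (gam_ i (n_ i)) x| < e].
(* If convergence fails, the bad indices are frequent, so some ultrafilter lives on them. Its limit
   kernel also tracks gamma, hence equals K by uniqueness, a contradiction. *)
have PF : ProperFilter (within P \oo).
  split; last exact: within_filter.
  rewrite /within /= => h; apply: nnear; apply: filterS h => i Pi.
  by apply: contrapT => /Pi.
have Poo : \oo `<=` within P \oo by exact: cvg_within.
have [U [K' [UP PU Kc [K'h K'1 K't]]]] := limit_exists PF Poo gamP agree ni.
have e1 : K = K'.
  apply: (@tracks_unique gamma gamma K K' 0) => // j; exists j.
  by rewrite dist_refl.
have UPP : U P by apply: PU; rewrite /within /=; exact: nearW.
have := @Kc x; rewrite -e1 => /cvgrPdist_lt /(_ e e0) near.
by have [i [Pi /Pi]] := filter_ex (filterI UPP near).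
Qed.

End Boundary.

Section UniformLimit.
Context {R : realType} {G : groupType} (S : set G) (W : seq (G * R)) (C theta : R).
Hypothesis genS : finite_symmetric_generating S.
Hypothesis walk : decaying_walk W C theta.

(** Otherwise pick for each N a bad ray and an index beyond N at which its kernel is already within
    e / 2 of its limit. [Morse_limit] applies to this sequence of rays and makes those values
    converge to [K x]. *)
Lemma Morse_limit_uniform (kappa : R -> {nonneg R}) (gamma : nat -> G) (K : G -> R) x e :
  geodesic_ray S gamma -> harmonic W K -> K 1%g = 1 -> tracks S W gamma K -> 0 < e ->
  exists N : nat, forall (gamma' : nat -> G) (k : R), kappa_Morse_rays S kappa gamma' ->
    (forall m, (m <= N)%N -> gamma' m = gamma m) ->
    mkernel W (gamma' n) x @[n --> \oo] --> k -> `|K x - k| < e.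
Proof.
move=> gam Kh K1 Kt e0; apply: contrapT => nN.
have e20 : 0 < e / 2 by rewrite divr_gt0.
have bad N : exists p : (nat -> G) * nat, [/\ kappa_Morse_rays S kappa p.1,
    forall m, (m <= N)%N -> p.1 m = gamma m, (N <= p.2)%N &
    e / 2 <= `|K x - mkernel W (p.1 p.2) x|].
  apply: contrapT => np; apply: nN; exists N => g k gP ag gk.
  rewrite ltNge; apply/negP => ek; apply: np.
  have /cvgrPdist_lt/(_ _ e20) near := gk.
  have [n [Nn nk]] := filter_ex (filterI (nbhs_infty_ge N) near).
  exists (g, n); split=> //=; move: nk => /= nk.
  have := ler_distD (mkernel W (g n) x) (K x) k; rewrite (distrC (mkernel _ _ _) k).
  move: ek nk; move: `|K x - k| `|k - _| `|K x - _| => p q t *; lra.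
have [p pP] := choice bad.
have gP i : kappa_Morse_rays S kappa (p i).1 by have [] := pP i.
have ag i m : (m <= i)%N -> (p i).1 m = gamma m by have [_ h _ _] := pP i; exact: h.
have ni i : (i <= (p i).2)%N by have [] := pP i.
have c : mkernel W ((p i).1 (p i).2) x @[i --> \oo] --> K x.
  exact: (@Morse_limit _ _ S W C theta genS walk kappa gamma K
    (fun N => (p N).1) (fun N => (p N).2) x gam Kh K1 Kt gP ag ni).
have /cvgrPdist_lt/(_ _ e20) near := c.
have [n h] := filter_ex near; have [_ _ _] := pP n.
by rewrite leNgt => /negP; apply.
Qed.

End UniformLimit.

(** * Injectivity *)

Section Injectivity.
Context {R : realType} {G : groupType} (S : set G) (W : seq (G * R)) (C theta : R).
Hypothesis genS : finite_symmetric_generating S.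
Hypothesis walk : decaying_walk W C theta.
Local Notation dist := (word_dist S).
Local Notation gr := (gr W).
Local Notation gb := (green_bound C theta).
Local Notation ball := (ball S).
Implicit Types (gamma : nat -> G) (K u : G -> R).

Lemma gr_diag_ge1 x : 1 <= gr x x.
Proof.
rewrite (gr_fix walk) /source eqxx lerDl; apply: markov_ge0 => [|z].
  exact: walk_prob walk.
exact: (gr_ge0 walk).
Qed.

Lemma last_true (P : nat -> Prop) m : P 0%N ->
  exists i, [/\ (i <= m)%N, P i & (i < m)%N -> ~ P i.+1].
Proof.
move=> P0; elim: m => [|m [i [im Pi H]]]; first by exists 0%N.
have [im'|mi] := ltnP i m; first by exists i; split=> //; [exact: leqW|move=> _; exact: H].
have [PS|nPS] := pselect (P i.+1).
  by exists i.+1; split=> //; lia.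
by exists i; split=> //; exact: leqW.
Qed.

(** If both alternatives fail, Q and Q' are at least three quarters of X and Y, but 9/16 > 1/2. In
    the application Q and Q' are Green functions killed on a ball. *)
Lemma three_quarters (X Y a a' Q Q' B : R) : 0 <= a -> 0 <= a' -> 0 < X -> 0 < Y ->
  X <= B * a + Q -> Y <= B * a' + Q' -> Q * Q' <= X * Y / 2 ->
  X <= (4 * B + 1) * a \/ Y <= (4 * B + 1) * a'.
Proof.
move=> a0 a'0 X0 Y0 hX hY hQ.
case: (leP X ((4 * B + 1) * a)) => [|h1]; first by left.
case: (leP Y ((4 * B + 1) * a')) => [|h2]; first by right.
have q1 : 3 * X / 4 <= Q by lra.
have q2 : 3 * Y / 4 <= Q' by lra.
have := ler_pM (ltac:(lra) : 0 <= 3 * X / 4) (ltac:(lra) : 0 <= 3 * Y / 4) q1 q2.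
have := mulr_gt0 X0 Y0; move: hQ => /[swap] XY h3 h4.
exfalso; have : 3 * X / 4 * (3 * Y / 4) <= X * Y / 2 := le_trans h4 h3.
have e : 3 * X / 4 * (3 * Y / 4) = 9 / 16 * (X * Y) by field.
by rewrite e; move: (X * Y) XY => t XY h; lra.
Qed.

(* Almost every path from [1] to [z'] that visits [z] meets the ball of radius
   [D] around each [p] of the ray ending at [z'].  For the first [p] this happens
   before the visit to [z] and for the last one after it, so some [p] is met both
   before and after. *)
Lemma detour_bound (kappa : R -> {nonneg R}) (A : R) : 0 < A -> exists d : nat,
  forall gamma, kappa_Morse_rays S kappa gamma ->
  forall z m, gr 1%g (gamma m) <= A * (gr 1%g z * gr z (gamma m)) ->
  exists i, (dist z (gamma i) <= d)%N.
Proof.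
move=> A0; have gb0 := green_bound_gt0 walk.
(* Chosen so that gb * eps * A = 1/2, the loss allowed by [three_quarters]. *)
pose eps := (2 * (gb * A))^-1.
have eps0 : 0 < eps by rewrite invr_gt0 mulr_gt0// mulr_gt0.
have [D DP] := weak_ancona genS walk kappa eps0.
have [B B0 BP] := hit_ball_le genS walk D.
have [c c1 [har1 har2]] := harnack genS walk; have c0 : 0 <= c := le_trans ler01 c1.
have [r Wr] := step_bound S W.
pose B3 := 4 * B + 1.
have B31 : 1 <= B3 by rewrite /B3 lerDr mulr_ge0.
have B30 : 0 < B3 := lt_le_trans ltr01 B31.
(* The product of all constants in the final chain G(1,z') <= L G(1,z') G(p,z). Beyond distance n *
   r the factor G(p,z) is at most 1 / (2 L), which is absurd. *)
pose L := A * B3 * (B3 * (c * c)) * gb * gb.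
have L0 : 0 < L.
  have c0' : 0 < c := lt_le_trans ltr01 c1.
  by do 4?[apply: mulr_gt0 => //]; exact: mulr_gt0.
have th01 : 0 <= theta < 1 by rewrite (walk_theta1 walk) ltW ?(walk_theta0 walk).
have L20 : 0 < (2 * L)^-1 by rewrite invr_gt0 mulr_gt0.
have [n nP] := pow_small th01 (ltW gb0) L20.
exists (n * r)%N => gamma gam z m hz; set z' := gamma m in hz.
have g0 x y := gr_ge0 walk x y.
have geo : geodesic_ray S gamma by case: gam.
have gam0 : gamma 0%N = 1%g by case: geo.
pose before i : Prop := gr 1%g z <= B3 * (gr 1%g (gamma i) * gr (gamma i) z).
pose after i : Prop := gr z z' <= B3 * (gr z (gamma i) * gr (gamma i) z').
have dich i : (i <= m)%N -> before i \/ after i.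
  move=> im; set p := gamma i; set b := ball p D.
  have anc := DP gamma gam 1%g i m; rewrite word_norm1// muln0 im in anc.
  have {}anc := anc isT; rewrite -/p -/b -/z' in anc.
  have d1 := gr_decomp walk b 1%g z; have d2 := gr_decomp walk b z z'.
  have h1 := BP _ 1%g p (superharmonic_gr walk z).
  have h2 := BP _ z p (superharmonic_gr walk z').
  have q := @kgr_mul_le _ _ _ _ _ walk (mem b) (kgr W (mem b) ^~ z') 1%g z
    (fun x => kgr_ge0 walk _ x z') (kgr_superharmonic walk (mem b) z').
  have k1 := kgr_ge0 walk (mem b) 1%g z; have k2 := kgr_ge0 walk (mem b) z z'.
  have k3 := kgr_le walk (mem b) 1%g z.
  rewrite -/b in h1 h2.
  have {}q : kgr W (mem b) 1%g z * kgr W (mem b) z z' <= (gr 1%g z * gr z z') / 2.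
    apply: (le_trans q); apply: (le_trans (ler_wpM2l (ltW gb0) anc)).
    apply: (@le_trans _ _ (gb * (eps * (A * (gr 1%g z * gr z z'))))).
      by rewrite !ler_wpM2l// ltW.
    rewrite le_eqVlt; apply/orP; left; apply/eqP.
    by rewrite /eps; field; rewrite !gt_eqF.
  have {d1}d1 := le_trans d1 (lerD h1 (lexx _)).
  have {d2}d2 := le_trans d2 (lerD h2 (lexx _)).
  rewrite /before /after -/p.
  have p1 : 0 <= gr 1%g p * gr p z by rewrite mulr_ge0.
  have p2 : 0 <= gr z p * gr p z' by rewrite mulr_ge0.
  have X0 := gr_gt0 walk 1%g z; have Y0 := gr_gt0 walk z z'.
  exact: three_quarters p1 p2 X0 Y0 d1 d2 q.
have b0 : before 0%N.
  rewrite /before gam0 mulrA ler_peMl//.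
  by rewrite -[X in X <= _]mulr1; apply: ler_pM => //; exact: gr_diag_ge1.
(* At the last index satisfying [before], the next one satisfies [after]; Harnack across one edge,
   in both variables, transfers this back at the cost c * c. If i = m, then p = z' and [after] is
   immediate from G(z',z') >= 1. *)
have [i [im bi nbS]] := last_true m b0.
pose p := gamma i.
have aft : gr z z' <= B3 * (c * c) * (gr z p * gr p z').
  have B3cc : B3 <= B3 * (c * c).
    by rewrite ler_peMr ?(ltW B30)// -[X in X <= _]mulr1; apply: ler_pM.
  have [im'|mi] := ltnP i m.
    case: (dich i.+1 im') => [/(nbS im')//|].
    rewrite /after => /le_trans; apply; rewrite -mulrA ler_wpM2l ?(ltW B30)//.
    have d1 : dist p (gamma i.+1) = 1%N.
      by rewrite /p geodesic_dist// subSnn (eqP (leqnSn i)).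
    have e1 := har2 z (gamma i.+1) p; rewrite dist_sym// d1 expr1 in e1.
    have e2 := har1 _ p (gamma i.+1) (superharmonic_gr walk z'); rewrite d1 expr1 in e2.
    by rewrite mulrACA; apply: ler_pM.
  have -> : p = z' by rewrite /p /z'; congr gamma; apply/eqP; rewrite eqn_leq im.
  have e1 : gr z z' <= gr z z' * gr z' z' by rewrite ler_peMr// gr_diag_ge1.
  apply: (le_trans e1); rewrite ler_peMl ?mulr_ge0//; exact: le_trans B3cc.
exists i; rewrite leqNgt dist_sym//; apply/negP => far.
have g1 := gr_far genS walk Wr far; have g2 := nP n (leqnn n).
have z'0 := gr_gt0 walk 1%g z'.
have pz' := gr_mul_le walk 1%g p (superharmonic_gr walk z').
have zp := gr_le_bound walk z p.
have h1 : gr 1%g z * gr z z' <= B3 * (gr 1%g p * gr p z) * (B3 * (c * c) * (gr z p * gr p z')).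
  by apply: ler_pM => //; exact: bi.
have h2 : gr 1%g z' <= L * gr 1%g z' * (2 * L)^-1.
  apply: (le_trans hz); apply: (le_trans (ler_wpM2l (ltW A0) h1)).
  have -> : A * (B3 * (gr 1%g p * gr p z) * (B3 * (c * c) * (gr z p * gr p z'))) =
    A * B3 * (B3 * (c * c)) * ((gr 1%g p * gr p z') * gr z p * gr p z) by ring.
  have -> : L * gr 1%g z' * (2 * L)^-1 =
    A * B3 * (B3 * (c * c)) * ((gb * gr 1%g z') * gb * (2 * L)^-1).
    by rewrite {1}/L; move: gb => g; ring.
  apply: ler_wpM2l; first by rewrite !mulr_ge0// ltW.
  apply: ler_pM => //; first by rewrite !mulr_ge0.
    by apply: ler_pM => //; rewrite mulr_ge0.
  exact: le_trans g2.
have : L * gr 1%g z' * (2 * L)^-1 = gr 1%g z' / 2 by field; rewrite gt_eqF.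
by move=> e; rewrite e in h2; move: z'0 h2; set v := gr 1%g z' => *; lra.
Qed.

(** Tracking, evaluated at 1, gives 1 <= B G(1,z) K(z) for z on gamma. Since K(z) is also the limit
    of G(z,z') / G(1,z') along gamma', the hypothesis of [detour_bound] holds for some z' with A = 2
    (B + 1). *)
Lemma equal_limits_close (kappa : R -> {nonneg R}) gamma gamma' K : superharmonic W K ->
  K 1%g = 1 -> tracks S W gamma K -> kappa_Morse_rays S kappa gamma' ->
  (forall x, mkernel W (gamma' n) x @[n --> \oo] --> K x) ->
  exists d : nat, forall j, exists i, (dist (gamma j) (gamma' i) <= d)%N.
Proof.
move=> Ks K1 Kt gam' Kc; have [B B0 BP] := tracks_le genS walk Ks Kt.
have B10 : 0 < 2 * (B + 1) by rewrite mulr_gt0// ltr_wpDl.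
have [d dP] := detour_bound kappa B10; exists d => j; set z := gamma j.
have := BP 1%g j; rewrite word_norm1// muln0 K1 -/z => /(_ (leq0n j)) Bz.
have gz := gr_gt0 walk 1%g z.
have Kz : 0 < K z.
  rewrite ltNge; apply/negP => Kz; have : B * (gr 1%g z * K z) <= 0.
    by rewrite mulr_ge0_le0// mulr_ge0_le0// ltW.
  by move: Bz; lra.
have [m mP] : exists m, K z / 2 <= mkernel W (gamma' m) z.
  have [m _ mP] : \forall m \near \oo, K z / 2 <= mkernel W (gamma' m) z.
    by apply: cvgr_ge (@Kc z) _ _; rewrite ltr_pdivrMr//; lra.
  by exists m; apply: mP => /=.
apply: (dP gamma' gam' z m); move: mP; rewrite /mkernel ler_pdivlMr ?(gr_gt0 walk)//.
set z' := gamma' m => mP; have g' := gr_gt0 walk 1%g z'.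
have h1 : gr 1%g z' <= B * (gr 1%g z * K z) * gr 1%g z' by rewrite ler_peMl// ltW.
have -> : 2 * (B + 1) * (gr 1%g z * gr z z') = (B + 1) * gr 1%g z * (2 * gr z z') by ring.
apply: (le_trans h1).
have -> : B * (gr 1%g z * K z) * gr 1%g z' = B * gr 1%g z * (K z * gr 1%g z') by ring.
have gz0 := ltW gz; have Kz0 := ltW Kz; have g'0 := ltW g'.
apply: ler_pM; [exact: mulr_ge0|exact: mulr_ge0|by rewrite ler_wpM2r// lerDl|].
by move: mP; move: (K z) (gr 1%g z') (gr z z') => k u v; lra.
Qed.

End Injectivity.

(** * The lazy walk and the original one *)

Section LazyGreen.
Context {R : realType} {G : groupType}.
Implicit Types (W : seq (G * R)).

Lemma markov_lazy W f (x : G) : markov (lazy W) f x = 2^-1 * f x + 2^-1 * markov W f x.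
Proof.
rewrite /markov big_cons big_map /= mulg1 mulr_sumr; congr (_ + _).
by apply: eq_bigr => a _; rewrite [a.2 / 2]mulrC -mulrA.
Qed.

(** The lazy walk spends on average twice as long at each position. Minimality of potentials is used
    both ways: half the lazy Green function is a supersolution for W, which also gives convergence,
    and twice the potential of W is one for the lazy walk. *)
Lemma green_lazy W C theta x y : weighted_prob W -> decaying_walk (lazy W) C theta ->
  (fun N => \sum_(0 <= n < N) cpow W n (x^-1 * y)%g) @ \oo --> gr (lazy W) x y / 2.
Proof.
move=> Wp walk; pose v z := gr (lazy W) z y / 2.
have s0 := @source_ge0 R G y.
have sv : supersolution W predT (source y) v.
  split=> z; first by rewrite divr_ge0// (gr_ge0 walk).
  rewrite mul1r /v (_ : (fun z => _) = (fun z => 2^-1 * gr (lazy W) z y)); last first.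
    by apply/funext => t; rewrite mulrC.
  have := gr_fix walk z y; rewrite markov_lazy => e; rewrite markovZ.
  by move: e; set a := gr _ _ _; set b := markov _ _ _; set s := source _ _ => e; lra.
have c := @pot_cvg _ _ W Wp predT (source y) v x s0 sv.
under eq_fun do rewrite -pot_source.
suff -> : gr (lazy W) x y / 2 = Pot W predT (source y) x by exact: c.
apply/eqP; rewrite eq_le; apply/andP; split; last exact: (Pot_le Wp x s0 sv).
rewrite ler_pdivrMr//.
pose v2 z := 2 * Pot W predT (source y) z.
rewrite mulrC; apply: (@Pot_le _ _ _ (walk_prob walk) predT (source y) v2 x s0).
split=> z; first by rewrite mulr_ge0//; exact: (Pot_ge0 Wp _ s0 sv).
rewrite mul1r markov_lazy markovZ; have := Pot_fix Wp z s0 sv; rewrite mul1r /v2.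
by set a := Pot _ _ _ z; set b := markov _ _ _; set s := source _ _ => e; lra.
Qed.

End LazyGreen.

Section Transfer.
Context {R : realType} {G : groupType} (mu : G -> R).
Hypothesis muP : finitely_supported_probability mu.

Definition steps : seq (G * R) :=
  [seq (a, mu a) | a <- finmap.enum_fset (fset_set [set x | mu x != 0])].

Lemma lconv_steps f : lconv steps f = convolution mu f.
Proof.
have [mu0 mufin _] := muP; apply/funext => z.
rewrite /lconv /convolution big_map /=.
rewrite -(fsbig_widen [set x | mu x != 0])//; last first.
  by move=> y [_ /= /negP/negPn/eqP ->]; rewrite mul0r.
by rewrite fsbig_finite.
Qed.

Lemma weighted_prob_steps : weighted_prob steps.
Proof.
have [mu0 mufin mu1] := muP; split=> [a /mapP[b _ ->]|]; first exact: mu0.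
rewrite /steps big_map /= -mu1 -(fsbig_widen [set x | mu x != 0])//; last first.
  by move=> y [_ /= /negP/negPn/eqP ->].
by rewrite fsbig_finite.
Qed.

Lemma cpow_steps n : cpow steps n = convolution_power mu n.
Proof.
elim: n => [//|n IH]; rewrite /cpow /= -/(cpow steps n) lconv_steps IH //.
Qed.

Lemma martin_kernel_lazy C theta : decaying_walk (lazy steps) C theta ->
  martin_kernel mu = mkernel (lazy steps).
Proof.
move=> walk.
have gE x y : green mu x y = (gr (lazy steps) x y / 2)%:E.
  have c := @green_lazy _ _ steps C theta x y weighted_prob_steps walk.
  rewrite /green (_ : (fun N => _) =
      (fun N => (\sum_(0 <= n < N) cpow steps n (x^-1 * y)%g)%:E)); last first.
    apply/funext => N; rewrite /transition sumEFin; congr (_%:E).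
    by apply: eq_bigr => n _; rewrite cpow_steps.
  apply: cvg_lim; first exact: ereal_hausdorff.
  by apply: cvg_EFin => //; exact: nearW.
apply/funext => y; apply/funext => x; rewrite /martin_kernel /mkernel !gE /=.
have g0 := gr_gt0 walk 1%g y; field; rewrite gt_eqF//.
Qed.

End Transfer.

Section PathTopology.
Context {G : groupType}.

Lemma near_agree (gamma : vertex_path G) (N : nat) :
  \forall g \near gamma, forall m, (m <= N)%N -> (g : nat -> G) m = gamma m.
Proof.
have ev m : \forall g \near gamma, (g : nat -> G) m = gamma m.
  have := @fam_compact_nbhs nat (discrete_topology G) [set m] [set gamma m] gamma.
  move=> h; apply: filterS (h _ _ _ _) => [g /(_ m erefl)//||||].
  - exact: discrete_open.
  - by move=> _ [_ -> <-].
  - exact: compact_set1.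
  - by move=> n A /nbhs_singleton An; apply/principal_filterP.
elim: N => [|N IH].
  by apply: filterS (ev 0%N) => g g0 m; rewrite leqn0 => /eqP ->.
apply: filterS (filterI IH (ev N.+1)) => g [gN gS] m.
by rewrite leq_eqVlt ltnS => /predU1P[->//|]; exact: gN.
Qed.

End PathTopology.

(** * The map to the Martin boundary *)

Section HausdorffDistance.
Context {G : groupType} (S : set G).
Hypothesis genS : finite_symmetric_generating S.
Local Notation dist := (word_dist S).
Local Notation fHd := (finite_Hausdorff_dist S).

Lemma fHd_refl A : fHd A A.
Proof. by exists 0%N; split=> x Ax; exists x => //; rewrite dist_refl. Qed.

Lemma fHd_sym A B : fHd A B -> fHd B A.
Proof. by move=> [n [AB BA]]; exists n. Qed.

Lemma fHd_trans B A D : fHd A B -> fHd B D -> fHd A D.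
Proof.
move=> [n [AB BA]] [m [BD DB]]; exists (n + m)%N; split.
  move=> x /AB[y /BD[z Dz yz] xy]; exists z => //.
  by rewrite (leq_trans (dist_tri genS y _ _))// leq_add.
move=> z /DB[y /BA[x Ax yx] zy]; exists x => //.
by rewrite (leq_trans (dist_tri genS y _ _))// addnC leq_add.
Qed.

Lemma ray_class_eq (R : realType) (gamma gamma' : vertex_path G) :
  fHd (range gamma) (range gamma') -> ray_class R S gamma = ray_class R S gamma'.
Proof.
move=> gg'; apply/seteqP; split=> t [tM th]; split=> //.
  exact: fHd_trans (fHd_sym gg') th.
exact: fHd_trans gg' th.
Qed.

End HausdorffDistance.

Lemma geodesic_ray_leaves (G : groupType) (S : set G) (gamma : nat -> G) :
  finite_symmetric_generating S -> geodesic_ray S gamma -> leaves_finite_sets gamma.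
Proof.
move=> genS [g0 geo] F Ffin.
have [N NP] : exists N, forall g, F g -> (word_norm S g <= N)%N.
  have FE (g : G) : F g -> g \in finmap.enum_fset (fset_set F).
    by move=> Fg; have := in_fset_set Ffin g; rewrite mem_set.
  suff [N NP] : exists N, forall g, g \in finmap.enum_fset (fset_set F) ->
      (word_norm S g <= N)%N by exists N => g /FE/NP.
  elim: (finmap.enum_fset (fset_set F)) => [|g r [N IH]]; first by exists 0%N.
  exists (maxn (word_norm S g) N) => h; rewrite inE => /predU1P[->|/IH hN].
    exact: leq_maxl.
  by rewrite (leq_trans hN)// leq_maxr.
exists N.+1 => // n /= Nn /NP; have := geo 0%N n (leq0n n).
by rewrite g0 /word_dist invg1 mul1g subn0 => ->; rewrite leqNgt Nn.
Qed.

Section MorseToMartin.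
Context {R : realType} {G : groupType} (S : set G) (W : seq (G * R)) (C theta : R).
Hypothesis genS : finite_symmetric_generating S.
Hypothesis walk : decaying_walk W C theta.
Local Notation mk := (mkernel W).
Implicit Types (xi : Morse_boundary R S).

(** One ray of the class suffices here; [represents_tracks] extends the property to all of them, so
    a choice of K for each xi is independent of rays. *)
Definition represents (xi : Morse_boundary R S) (K : G -> R) : Prop :=
  exists gamma : vertex_path G, [/\ Morse_rays R S gamma, set_val xi = ray_class R S gamma,
    harmonic W K, K 1%g = 1 & tracks S W gamma K].

Lemma represents_exists xi : exists K, represents xi K.
Proof.
have [gamma [kappa _ gP] gE] := set_valP xi.
have [U [K [_ _ _ [Kh K1 Kt]]]] := @limit_exists _ _ S W C theta genS walk kappa gamma
  (fun=> gamma) id \oo _ (@subset_refl _ _) (fun=> gP) (fun _ _ _ => erefl) leqnn.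
by exists K, gamma; split=> //; exists kappa.
Qed.

Lemma represents_tracks xi K (gamma : vertex_path G) : represents xi K ->
  rays_of xi gamma -> [/\ Morse_rays R S gamma, harmonic W K, K 1%g = 1 & tracks S W gamma K].
Proof.
move=> [gamma0 [g0M xiE Kh K1 Kt]]; rewrite /rays_of xiE => -[gM [n [g0g gg0]]].
split=> //; have [kappa _ gP] := gM.
have [U [K' [_ _ _ [K'h K'1 K't]]]] := @limit_exists _ _ S W C theta genS walk kappa gamma
  (fun=> gamma) id \oo _ (@subset_refl _ _) (fun=> gP) (fun _ _ _ => erefl) leqnn.
suff -> : K = K' by [].
have [kappa0 _ [geo0 _]] := g0M; have [geo _] := gP.
apply: (@tracks_unique _ _ S W C theta genS walk gamma0 gamma K K' n) => // j.
by have [_ [i _ <-] h] := g0g _ (imageT gamma0 j); exists i.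
Qed.

Lemma represents_limit xi K (gamma : vertex_path G) x : represents xi K ->
  rays_of xi gamma -> mk (gamma n) x @[n --> \oo] --> K x.
Proof.
move=> xiK /(represents_tracks xiK)[[kappa _ gP] Kh K1 Kt]; have [geo _] := gP.
exact: (@Morse_limit _ _ S W C theta genS walk kappa gamma K
  (fun=> gamma) id x geo Kh K1 Kt (fun=> gP) (fun _ _ _ => erefl) leqnn).
Qed.

Lemma rays_of_class xi (gamma : vertex_path G) : Morse_rays R S gamma ->
  set_val xi = ray_class R S gamma -> rays_of xi gamma.
Proof. by move=> gM xiE; rewrite /rays_of xiE; split=> //; exact: fHd_refl. Qed.

Lemma represents_inj xi xi' K : represents xi K -> represents xi' K -> xi = xi'.
Proof.
move=> xK xK'; have [g [gM gE Kh K1 Kt]] := xK; have [g' [g'M g'E _ _ K't]] := xK'.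
apply: val_inj; rewrite -!set_valE gE g'E; apply: ray_class_eq => //.
have Ks := harmonic_superharmonic Kh.
have [kappa _ gP] := gM; have [kappa' _ g'P] := g'M.
have c x : mk (g n) x @[n --> \oo] --> K x.
  exact: represents_limit xK (rays_of_class gM gE).
have c' x : mk (g' n) x @[n --> \oo] --> K x.
  exact: represents_limit xK' (rays_of_class g'M g'E).
have [d dP] := equal_limits_close genS walk Ks K1 Kt g'P c'.
have [d' d'P] := equal_limits_close genS walk Ks K1 K't gP c.
exists (maxn d d'); split=> _ [j _ <-].
  by have [i h] := dP j; exists (g' i) => //; rewrite (leq_trans h)// leq_maxl.
by have [i h] := d'P j; exists (g i) => //; rewrite (leq_trans h)// leq_maxr.
Qed.

Lemma represents_continuous (Phi : Morse_boundary R S -> G -> R) x :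
  (forall xi, represents xi (Phi xi)) -> continuous (fun xi => Phi xi x).
Proof.
move=> PhiP; apply/continuousP => A oA; apply/direct_limit_openE => kappa.
(* Strata carry quotient topologies and the boundary their direct limit, so continuity is tested on
   the rays of one gauge, where nearby rays share long initial segments. *)
suff cont : continuous (fun g : kappa_Morse_rays S kappa => Phi (kappa_ray_class g) x).
  by move/continuousP : cont => /(_ A oA).
move=> g; apply/(@cvgrPdist_lt _ _ _ _ (nbhs_filter g)) => e e0.
have rays (h : kappa_Morse_rays S kappa) : rays_of (kappa_ray_class h) (set_val h).
  split; last exact: fHd_refl.
  by exists kappa => //; exact: set_valP.
have [_ Kh K1 Kt] := represents_tracks (PhiP (kappa_ray_class g)) (rays g).
have [geo _] := set_valP g.
have [N NP] := Morse_limit_uniform genS walk kappa x geo Kh K1 Kt e0.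
have : \forall h \near g, forall m, (m <= N)%N ->
    (set_val h : nat -> G) m = (set_val g : nat -> G) m.
  exact: (@initial_continuous _ _ set_val g _ (near_agree (set_val g) N)).
apply: (@filterS _ _ (nbhs_filter g)) => h hg; apply: (NP (set_val h)) => //; first exact: set_valP.
exact: represents_limit (PhiP _) (rays h).
Qed.

End MorseToMartin.

Unset Implicit Arguments.

Theorem corollary1p12 (R : realType) (G : groupType) (S : set G) (mu : G -> R)
  (genS : finite_symmetric_generating S)
  (nonamenG : ~ amenable R G)
  (muP : finitely_supported_probability mu)
  (mu_irr : irreducible mu) :
  exists Psi : Morse_boundary R S -> Martin_boundary mu,
    [/\ forall (xi : Morse_boundary R S) (gamma : nat -> G),
          rays_of xi gamma ->
          {ptws, martin_kernel mu (gamma n) @[n --> \oo] --> set_val (Psi xi)},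
        injective Psi
      & continuous Psi].
Proof.
have Wp := weighted_prob_steps muP.
have irr x : exists n, 0 < cpow (steps mu) n x.
  have [n] := mu_irr 1%g x; rewrite /transition invg1 mul1g => h.
  by exists n; rewrite cpow_steps.
have [C [theta [C0 th0 th1 decay]]] := lazy_decay genS nonamenG Wp irr.
have walk : decaying_walk (lazy (steps mu)) C theta.
  split=> //; first exact: weighted_prob_lazy.
  by move=> x; have [n h] := irr x; exists n; exact: cpow_lazy_gt0 h.
have mkE := martin_kernel_lazy muP walk.
have [Phi PhiP] := choice (represents_exists genS walk).
have lim (xi : Morse_boundary R S) (gamma : vertex_path G) : rays_of xi gamma ->
    {ptws, martin_kernel mu (gamma n) @[n --> \oo] --> Phi xi}.
  move=> xg; apply/(@pointwise_cvgP (discrete_topology G) R) => x; rewrite mkE.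
  exact: (@represents_limit _ _ S _ C theta genS walk xi (Phi xi) gamma x
    (PhiP xi) xg).
have PhiM xi : Martin_boundary mu (Phi xi).
  have [gamma [gM gE _ _ _]] := PhiP xi.
  exists gamma; last by apply: lim; exact: rays_of_class.
  have [kappa _ [geo _]] := gM.
  exact: geodesic_ray_leaves genS geo.
exists (fun xi => exist _ (Phi xi) (mem_set (PhiM xi))); split.
- by move=> xi gamma xg; exact: (lim xi gamma xg).
- move=> xi xi' /(congr1 sval) /= e; apply: (represents_inj genS walk (PhiP xi)).
  by rewrite e.
- apply: continuous_comp_initial => xi.
  apply: (proj2 (@pointwise_cvgP (discrete_topology G) R _ _
    (fmap_filter _ (nbhs_filter xi)))) => x.
  have c := @represents_continuous _ _ S _ C theta genS walk Phi x PhiP xi.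
  by move=> A /c.
Qed.
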